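(* Let $\mathcal{X}$, $\mathcal{V}$, the mesh $t_n=n/m$, and the measures $\Lambda_t,\mathbb{Q}_t,\nu_t,\mu_t$ and $\Lambda^{(m)}_{t_n},\mathbb{Q}^{(m)}_{t_n},\nu^{(m)}_{t_n},\mu^{(m)}_{t_n}$ be as in the context. (1) In case (D), for every integer $m\ge 1$ and every integer time $n\in\mathbb{N}$, $$\nu^{(m)}_{n}=\nu_{n}=\gamma_{n}\qquad\text{and}\qquad \mu^{(m)}_{n}=\mu_{n}=\eta_{n}.$$ (2) In case (C), for every $m\ge 1$ and every mesh time $t_n=n/m$ we have the first order decompositions $$\Lambda_{t_n}^{(m)}=\Lambda_{t_n}+\frac1m\, r_{m,t_n}\qquad\text{and}\qquad \mathbb{Q}_{t_n}^{(m)}=\mathbb{Q}_{t_n}+\frac1m\,\overline r_{m,t_n}$$ for some signed measures $r_{m,t_n},\overline r_{m,t_n}$ on $\Omega_{t_n}$ such that $$\sup_{m\ge 1}\left[\|\overline r_{m,t_n}\|_{\rm tv}\vee\|r_{m,t_n}\|_{\rm tv}\right]<\infty ,$$ where the supremum is taken, for a fixed value $t=t_n$ of the time, over all $m\ge1$ such that $t$ belongs to the mesh $\{k/m: k\ge 0\}$.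
   Context: $E$ is a Polish space with Borel $\sigma$-field $\mathcal{E}$; $\mathcal{B}_b(E)$ is the Banach space of bounded Borel functions with the uniform norm $\|\cdot\|$; $\mathbb N=\{0,1,2,\dots\}$. $(\mathcal{X}_t)_{t\ge 0}$ is an $E$-valued Markov process with càdlàg paths (canonical process on the Skorokhod space $D(\mathbb{R}_+,E)$, with the usual augmented filtration), and $\mathcal{V}_t$ is a time-inhomogeneous bounded Borel function on $E$. Put $\Omega_t=D([0,t],E)$. For a signed measure $r$ on $\Omega_t$, $\|r\|_{\rm tv}=\sup|r(f)|$ over measurable $f:\Omega_t\to\mathbb R$ with $\|f\|\le 1$. For bounded measurable $f$ on $\Omega_t$, $$\Lambda_t(f)=\mathbb{E}\Big(f(\mathcal{X}_{[0,t]})\exp\Big(\int_0^t\mathcal{V}_s(\mathcal{X}_s)ds\Big)\Big),\qquad \mathbb{Q}_t(f)=\Lambda_t(f)/\Lambda_t(1),$$ and $\nu_t$, $\mu_t$ are the $t$-marginals of $\Lambda_t$, $\mathbb{Q}_t$. For an integer $m\ge1$ let $t_k=k/m$, $k\ge0$, and for bounded measurable $f$ on $\Omega_{t_n}$, $$\Lambda^{(m)}_{t_n}(f)=\mathbb{E}\Big(f(\mathcal{X}_{[0,t_n]})\prod_{0\le p<n}e^{\mathcal{V}_{t_p}(\mathcal{X}_{t_p})/m}\Big),\qquad \mathbb{Q}^{(m)}_{t_n}(f)=\Lambda^{(m)}_{t_n}(f)/\Lambda^{(m)}_{t_n}(1),$$ with $t_n$-marginals $\nu^{(m)}_{t_n}$,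 $\mu^{(m)}_{t_n}$. At an integer time $n$ (which is the mesh point $t_{nm}$) we write $\nu_n^{(m)},\mu_n^{(m)}$ for $\nu^{(m)}_{t_{nm}},\mu^{(m)}_{t_{nm}}$. Case (D): $\mathcal{X}_t=X_{\lfloor t\rfloor}$ and $\mathcal{V}_t=\log G_{\lfloor t\rfloor}$, where $(X_n)_{n\in\mathbb{N}}$ is an $E$-valued Markov chain and $G_n$ are positive Borel functions with $\log G_n$ bounded. For $f\in\mathcal{B}_b(E)$, $\gamma_n(f)=\mathbb{E}\big(f(X_n)\prod_{0\le p<n}G_p(X_p)\big)$ and $\eta_n(f)=\gamma_n(f)/\gamma_n(1)$. Case (C): $\mathcal{X}_t$ is a continuous time Markov process with infinitesimal generators $L_t:D(L)\to D(L)$ on a common domain $D(L)$, and $\mathcal{V}\in\mathcal{C}^1(\mathbb{R}_+,D(L))$. The set $D(L)$ is a sub-algebra of $\mathcal{B}_b(E)$ generating $\mathcal{E}$. For any measurable $\mathcal{U}:t\in\mathbb R_+\mapsto\mathcal{U}_t\in D(L)$, the Feynman-Kac semigroup $\mathcal{Q}_{s,t}(f)(x)=\mathbb{E}\big(f(\mathcal{X}_t)\exp(\int_s^t\mathcal{U}_r(\mathcal{X}_r)dr)\,|\,\mathcal{X}_s=x\big)$, $s\le t$, satisfies $\mathcal{Q}_{s,t}(D(L))\subset D(L)$. For any $s\le t$ (and $f\in D(L)$) the mappings $r\in[0,s]\mapsto L_r(\mathcal{Q}_{s,t}(f)^2)$ and $r\in[0,s]\mapsto L_r^2(\mathcal{Q}_{s,t}(f)^2)$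 are in $\mathcal{C}^1([0,s],D(L))$, and their norms and the norms of their first order derivatives only depend on $(\mathcal{X}_s)_{s\le t}$ and on the norms of the functions $(\mathcal{U}_s)_{s\le t}$ and of their derivatives. These conditions allow the use of stochastic calculus: for $f\in\mathcal{C}^1(\mathbb{R}_+,D(L))$, $df_t(\mathcal{X}_t)=(\partial_t+L_t)(f_t)(\mathcal{X}_t)dt+dM_t(f)$ with a martingale $M_t(f)$ with predictable angle bracket $d\langle M(f)\rangle_t=\Gamma_{L_t}(f_t,f_t)(\mathcal{X}_t)dt$, where $\Gamma_{L}(f,f)(x)=L((f-f(x))^2)(x)$. *)

(* Defs.v *)
From HB Require Import structures.
From mathcomp Require Import all_boot all_order all_algebra.
From mathcomp Require Import lra.
From mathcomp Require Import all_classical all_reals all_analysis.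

Set Implicit Arguments.
Unset Strict Implicit.
Unset Printing Implicit Defensive.

Import Order.TTheory GRing.Theory Num.Theory.
Import numFieldNormedType.Exports.

Local Open Scope classical_set_scope.
Local Open Scope ring_scope.

(* A Polish space is a complete pseudometric space (with a chosen metric), *)
(* together with the following separation and separability conditions.      *)
Definition polish (R : realType) (E : completePseudoMetricType R) : Prop :=
  hausdorff_space E /\ exists S : set E, countable S /\ dense S.

Notation borel E := (g_sigma_algebraType (@open E)).

Definition bounded_measurable (R : realType) (d : measure_display)
    (T : measurableType d) (f : T -> R) : Prop :=
  measurable_fun [set: T] f /\ bounded_fun f.

Definition cadlag (R : realType) (E : completePseudoMetricType R)
    (omega : R -> E) : Prop :=
  forall t : R, omega s @[s --> t^'+] --> omega t /\
                cvg (omega s @[s --> t^'-]).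

(* Nearest point of the time interval [0, T] (T finite) or [0, +oo[. *)
Definition clamp (R : realType) (T : \bar R) (s : R) : R :=
  match T with
  | u%:E => Num.max 0 (Num.min s u)
  | +oo%E => Num.max 0 s
  | -oo%E => 0
  end.

(* D([0, T], E), and D(R_+, E) for T = +oo: a path is represented by its    *)
(* unique extension to R that is constant outside the time interval, which  *)
(* is cadlag on R exactly when the path is cadlag.                          *)
Record skorokhod (R : realType) (E : completePseudoMetricType R)
    (T : \bar R) := Skorokhod {
  skorokhod_fun :> R -> E ;
  skorokhod_cadlag : cadlag skorokhod_fun ;
  skorokhod_clamp : forall s : R, skorokhod_fun s = skorokhod_fun (clamp T s) }.

HB.instance Definition _ (R : realType) (E : completePseudoMetricType R)
  (T : \bar R) := gen_eqMixin (skorokhod E T).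
HB.instance Definition _ (R : realType) (E : completePseudoMetricType R)
  (T : \bar R) := gen_choiceMixin (skorokhod E T).

Lemma cadlag_cst (R : realType) (E : completePseudoMetricType R) (x : E) :
  cadlag (fun _ : R => x).
Proof. by move=> t; split; [exact: cvg_cst | exact: is_cvg_cst]. Qed.

HB.instance Definition _ (R : realType) (E : completePseudoMetricType R)
  (T : \bar R) := isPointed.Build (skorokhod E T)
    (@Skorokhod R E T _ (cadlag_cst point) (fun=> erefl)).

Definition coordinate_events (R : realType) (E : completePseudoMetricType R)
    (T : \bar R) (J : set R) : set (set (skorokhod E T)) :=
  [set A | exists s (B : set (borel E)),
     [/\ J s, measurable B & A = [set w : skorokhod E T | B (w s)]]].

(* sigma(X_s, s \in J) for the canonical process X on D([0, T], E) *)
Definition sigma_coordinates (R : realType) (E : completePseudoMetricType R)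
    (T : \bar R) (J : set R) : set (set (skorokhod E T)) :=
  <<s coordinate_events J >>.

(* For a Polish space E, the sigma-field generated by all the coordinates   *)
(* is the Borel sigma-field of the Skorokhod topology.                      *)
HB.instance Definition _ (R : realType) (E : completePseudoMetricType R)
  (T : \bar R) := Measurable.copy (skorokhod E T)
    (g_sigma_algebraType (@coordinate_events R E T [set: R])).

Lemma cadlag_clamp (R : realType) (E : completePseudoMetricType R)
  (T : \bar R) (w : skorokhod E +oo%E) : cadlag (fun s => w (clamp T s)).
Proof.
case: T => [u| |] /=; last exact: cadlag_cst.
- have -> : (fun s => w (Num.max 0 (Num.min s u))) = fun s => w (Num.min s u).
    by apply/funext => s; rewrite [RHS](skorokhod_clamp w).
  have wE (t : R) := skorokhod_cadlag w t.
  move=> t; split => /=.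
  + case: (ltP t u) => tu.
      apply: (cvg_trans _ (proj1 (wE t))).
      apply: near_eq_cvg; near=> s; rewrite min_l//.
      by near: s; exact: nbhs_right_ltW.
    apply: cvg_near_cst; near=> s.
    by rewrite min_r// (le_trans tu)// ltW.
  + case: (leP t u) => tu.
      have [l wl] := (cvg_ex _).1 (proj2 (wE t)).
      apply/(cvg_ex _); exists l; apply: (cvg_trans _ wl).
      apply: near_eq_cvg; near=> s; rewrite min_l//.
      by rewrite (le_trans _ tu)// ltW.
    apply: (is_cvg_near_cst (w u)).
    by apply: filterS (nbhs_left_gt tu) => s us; rewrite min_r// ltW.
- have -> : (fun s => w (Num.max 0 s)) = w.
    by apply/funext => s; rewrite [RHS](skorokhod_clamp w).
  exact: skorokhod_cadlag.
Unshelve. all: by end_near. Qed.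

Lemma clamp_idem (R : realType) (T : \bar R) (s : R) :
  clamp T (clamp T s) = clamp T s.
Proof.
case: T => [u| |] //=; rewrite /Num.max /Num.min;
  repeat (case: ifPn => //); rewrite -?leNgt => *; lra.
Qed.

Definition stop_path (R : realType) (E : completePseudoMetricType R) (t : R)
    (w : skorokhod E +oo%E) : skorokhod E t%:E :=
  @Skorokhod R E t%:E (fun s => w (clamp t%:E s)) (cadlag_clamp t%:E w)
    (fun s => congr1 w (esym (clamp_idem t%:E s))).

Lemma cadlag_step (R : realType) (E : completePseudoMetricType R)
  (x : nat -> E) : cadlag (fun s : R => x (Num.truncn s)).
Proof.
move=> t; split.
- apply: cvg_near_cst; case: (ltP t 0) => t0.
    apply: filterS (nbhs_right_lt t0) => s s0; congr x.
    rewrite (truncn0Pn s _) ?(truncn0Pn t _)// -ltNge.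
      by rewrite (lt_trans t0).
    by rewrite (lt_trans s0).
  apply: filterS2 (nbhs_right_gt t) (nbhs_right_lt (truncnS_gt t)) => s ts st.
  by congr x; apply: truncn_def; rewrite st (le_trans _ (ltW ts))// truncn_le.
- case: (leP t 0) => t0.
    apply: (is_cvg_near_cst (x 0%N)).
    apply: filterS (nbhs_left_lt t) => s st; congr x.
    by apply/truncn0Pn; rewrite -ltNge (lt_trans st)// (le_lt_trans t0).
  pose n := (if (Num.truncn t)%:R == t then (Num.truncn t).-1
             else Num.truncn t).
  have /andP[nt tn] : n%:R < t <= n.+1%:R.
    rewrite /n; case: eqP => [tE|/eqP tN]; last first.
      by rewrite lt_neqAle tN truncn_le ltW// ltW// truncnS_gt.
    move: t0; rewrite -tE; case: (Num.truncn t) => [|k]; first by rewrite ltxx.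
    by move=> _; rewrite natrK /= lexx ltr_nat leqnn.
  apply: (is_cvg_near_cst (x n)).
  apply: filterS2 (nbhs_left_lt t) (nbhs_left_gt nt) => s st ns; congr x.
  by apply: truncn_def; rewrite (ltW ns) (lt_le_trans st).
Qed.

Lemma truncn_clamp (R : realType) (s : R) :
  Num.truncn s = Num.truncn (clamp +oo%E s).
Proof.
rewrite /clamp; case: (leP 0 s) => // s0; rewrite truncn0.
by apply/truncn0Pn; rewrite -ltNge (lt_trans s0).
Qed.

Definition step_path (R : realType) (E : completePseudoMetricType R)
    (x : nat -> E) : skorokhod E (+oo%E : \bar R) :=
  @Skorokhod R E +oo%E (fun s => x (Num.truncn s)) (cadlag_step x)
    (fun s => congr1 x (truncn_clamp s)).

(* The measures Lambda_t, Q_t and their marginals are given by their values *)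
(* on bounded measurable functions; V s x stands for V_s(x).               *)
Definition Lambda (R : realType) (E : completePseudoMetricType R)
    (V : R -> E -> R) (P : probability (skorokhod E +oo%E) R) (t : R)
    (f : skorokhod E t%:E -> R) : R :=
  \int[P]_w (f (stop_path t w) *
             expR (\int[lebesgue_measure]_(s in `[0, t]) V s (w s))).

Definition Qlaw (R : realType) (E : completePseudoMetricType R)
    (V : R -> E -> R) (P : probability (skorokhod E +oo%E) R) (t : R)
    (f : skorokhod E t%:E -> R) : R :=
  Lambda V P f / Lambda V P (fun _ : skorokhod E t%:E => 1).

Definition nu (R : realType) (E : completePseudoMetricType R)
    (V : R -> E -> R) (P : probability (skorokhod E +oo%E) R) (t : R)
    (f : E -> R) : R :=
  Lambda V P (fun w : skorokhod E t%:E => f (w t)).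

Definition mu (R : realType) (E : completePseudoMetricType R)
    (V : R -> E -> R) (P : probability (skorokhod E +oo%E) R) (t : R)
    (f : E -> R) : R :=
  Qlaw V P (fun w : skorokhod E t%:E => f (w t)).

(* The suffix _mesh denotes the approximation with time step 1/m at time   *)
(* mesh m n = n/m.                                                         *)
Definition mesh (R : realType) (m k : nat) : R := k%:R / m%:R.
Arguments mesh {R} m k.

Definition Lambda_mesh (R : realType) (E : completePseudoMetricType R)
    (V : R -> E -> R) (P : probability (skorokhod E +oo%E) R) (m n : nat)
    (f : skorokhod E (mesh m n)%:E -> R) : R :=
  \int[P]_w (f (stop_path (mesh m n) w) *
             \prod_(p < n) expR (V (mesh m p) (w (mesh m p)) / m%:R)).

Definition Qlaw_mesh (R : realType) (E : completePseudoMetricType R)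
    (V : R -> E -> R) (P : probability (skorokhod E +oo%E) R) (m n : nat)
    (f : skorokhod E (mesh m n)%:E -> R) : R :=
  Lambda_mesh V P f /
  Lambda_mesh V P (fun _ : skorokhod E (mesh m n)%:E => 1).

Definition nu_mesh (R : realType) (E : completePseudoMetricType R)
    (V : R -> E -> R) (P : probability (skorokhod E +oo%E) R) (m n : nat)
    (f : E -> R) : R :=
  Lambda_mesh V P (fun w : skorokhod E (mesh m n)%:E => f (w (mesh m n))).

Definition mu_mesh (R : realType) (E : completePseudoMetricType R)
    (V : R -> E -> R) (P : probability (skorokhod E +oo%E) R) (m n : nat)
    (f : E -> R) : R :=
  Qlaw_mesh V P (fun w : skorokhod E (mesh m n)%:E => f (w (mesh m n))).

(* r(f), through the Jordan decomposition of r (the choice of the Hahn      *)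
(* decomposition is immaterial).                                            *)
Definition charge_integral (R : realType) (d : measure_display)
    (T : measurableType d) (r : {charge set T -> \bar R}) (f : T -> R) : R :=
  let hP := svalP (cid (Hahn_decomposition r)) in
  let hPN := svalP (cid hP) in
  \int[jordan_pos hPN]_x f x - \int[jordan_neg hPN]_x f x.

Definition tv_norm (R : realType) (d : measure_display)
    (T : measurableType d) (r : {charge set T -> \bar R}) : \bar R :=
  ereal_sup [set `|charge_integral r f|%:E |
    f in [set f : T -> R |
      measurable_fun [set: T] f /\ forall x, `|f x| <= 1]].

Definition past_events (R : realType) (E : completePseudoMetricType R)
    (d : measure_display) (T : measurableType d)
    (X : nat -> T -> borel E) (n : nat) : set (set T) :=
  <<s [set A | exists k (B : set (borel E)),
         [/\ (k <= n)%N, measurable B & A = X k @^-1` B]] >>.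

Definition markov_chain (R : realType) (E : completePseudoMetricType R)
    (d : measure_display) (T : measurableType d) (Pr : probability T R)
    (X : nat -> {RV Pr >-> borel E}) : Prop :=
  exists M : nat -> R.-pker borel E ~> borel E,
    forall (n : nat) (A : set T) (B : set (borel E)),
      past_events (fun k => X k) n A -> measurable B ->
      Pr (A `&` X n.+1 @^-1` B) = (\int[Pr]_(w in A) M n (X n w) B)%E.

Definition step_law (R : realType) (E : completePseudoMetricType R)
    (d : measure_display) (T : measurableType d) (Pr : probability T R)
    (X : nat -> {RV Pr >-> borel E})
    (P : probability (skorokhod E +oo%E) R) : Prop :=
  forall A : set (skorokhod E +oo%E), measurable A ->
    P A = Pr [set w | A (step_path (fun n => X n w))].

Definition log_bounded (R : realType) (E : completePseudoMetricType R)
    (G : nat -> E -> R) : Prop :=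
  forall n, [/\ forall x, 0 < G n x,
                measurable_fun [set: borel E] (G n : borel E -> R)
              & bounded_fun (fun x => ln (G n x))].

Definition gamma (R : realType) (E : completePseudoMetricType R)
    (d : measure_display) (T : measurableType d) (Pr : probability T R)
    (X : nat -> {RV Pr >-> borel E}) (G : nat -> E -> R) (n : nat)
    (f : E -> R) : R :=
  \int[Pr]_w (f (X n w) * \prod_(p < n) G p (X p w)).

Definition eta (R : realType) (E : completePseudoMetricType R)
    (d : measure_display) (T : measurableType d) (Pr : probability T R)
    (X : nat -> {RV Pr >-> borel E}) (G : nat -> E -> R) (n : nat)
    (f : E -> R) : R :=
  gamma X G n f / gamma X G n (fun=> 1).

Definition sup_norm (R : realType) (E : Type) (f : E -> R) : R :=
  sup [set `|f x| | x in [set: E]].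

(* f \in C^1(J, D) with derivative f', where D is normed by the uniform     *)
(* norm of B_b(E); one-sided derivatives at the end points of J.            *)
Definition C1 (R : realType) (E : completePseudoMetricType R)
    (D : set (E -> R)) (J : set R) (f f' : R -> E -> R) : Prop :=
  forall t, J t ->
    [/\ D (f t), D (f' t),
        {uniform, (fun s x => (s - t)^-1 * (f s x - f t x)) @ within J t^'
                  --> f' t}
      & {uniform, f' @ within J (nbhs t) --> f' t}].

Definition bounded_subalgebra (R : realType)
    (E : completePseudoMetricType R) (D : set (E -> R)) : Prop :=
  [/\ forall f, D f -> bounded_measurable (f : borel E -> R),
      D (fun=> 1),
      forall (a : R) f g, D f -> D g -> D (fun x => a * f x + g x)
    & forall f g, D f -> D g -> D (fun x => f x * g x)].

Definition generates_borel (R : realType) (E : completePseudoMetricType R)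
    (D : set (E -> R)) : Prop :=
  <<s [set A | exists f (B : set R),
         [/\ D f, measurable B & A = f @^-1` B]] >> =
  [set A : set E | measurable (A : set (borel E))].

(* Markov property after time s of the canonical process under P, where     *)
(* K t x is the law of the process started from x at time t.                *)
Definition markov_from (R : realType) (E : completePseudoMetricType R)
    (K : R -> R.-pker borel E ~> skorokhod E (+oo%E : \bar R))
    (s : R) (P : {measure set (skorokhod E (+oo%E : \bar R)) -> \bar R}) :
    Prop :=
  forall (t : R) (A B : set (skorokhod E +oo%E)), s <= t ->
    sigma_coordinates `[s, t] A -> sigma_coordinates `[t, +oo[ B ->
    P (A `&` B) = (\int[P]_(w in A) K t (w t) B)%E.

Definition markov_process (R : realType) (E : completePseudoMetricType R)
    (K : R -> R.-pker borel E ~> skorokhod E (+oo%E : \bar R))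
    (P : probability (skorokhod E +oo%E) R) : Prop :=
  markov_from K 0 P /\
  forall (s : R) (x : E), 0 <= s ->
    K s x [set w : skorokhod E +oo%E | w s = x] = 1%E /\
    markov_from K s (K s x).

(* Q_{s,t}(f)(x) for the potential U; U = 0 gives the transition semigroup. *)
Definition feynman_kac (R : realType) (E : completePseudoMetricType R)
    (K : R -> R.-pker borel E ~> skorokhod E (+oo%E : \bar R))
    (U : R -> E -> R) (s t : R) (f : E -> R) (x : E) : R :=
  \int[K s x]_w (f (w t) *
                 expR (\int[lebesgue_measure]_(r in `[s, t]) U r (w r))).

Definition transition (R : realType) (E : completePseudoMetricType R)
    (K : R -> R.-pker borel E ~> skorokhod E (+oo%E : \bar R))
    (s t : R) (f : E -> R) (x : E) : R :=
  \int[K s x]_w f (w t).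

(* The derivative of the transition semigroup is taken pointwise, which is  *)
(* less demanding than a limit for the uniform norm.                        *)
Definition generators (R : realType) (E : completePseudoMetricType R)
    (K : R -> R.-pker borel E ~> skorokhod E (+oo%E : \bar R))
    (D : set (E -> R)) (L : R -> (E -> R) -> E -> R) : Prop :=
  forall s : R, 0 <= s ->
    [/\ forall f, D f -> D (L s f),
        forall (a : R) f g, D f -> D g ->
          L s (fun x => a * f x + g x) = (fun x => a * L s f x + L s g x)
      & forall f x, D f ->
          h^-1 * (transition K s (s + h) f x - f x) @[h --> 0^'+]
            --> L s f x].

(* Local boundedness in time makes the exponential weights integrable.      *)
Definition potential (R : realType) (E : completePseudoMetricType R)
    (D : set (E -> R)) (U : R -> E -> R) : Prop :=
  [/\ forall t, 0 <= t -> D (U t),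
      measurable_fun ((`[0, +oo[ : set R) `*` [set: borel E])
        (fun z : R * borel E => U z.1 z.2)
    & forall t, exists c : R, forall s x, 0 <= s <= t -> `|U s x| <= c].

Definition feynman_kac_regular (R : realType)
    (E : completePseudoMetricType R)
    (K : R -> R.-pker borel E ~> skorokhod E (+oo%E : \bar R))
    (D : set (E -> R)) (L : R -> (E -> R) -> E -> R) : Prop :=
  forall U, potential D U -> forall s t f, 0 <= s <= t -> D f ->
    let q := feynman_kac K U s t f in
    [/\ D q,
        exists g', C1 D `[0, s] (fun r => L r (fun x => q x ^+ 2)) g'
      & exists h', C1 D `[0, s] (fun r => L r (L r (fun x => q x ^+ 2))) h'].

(* The norms of the functions of feynman_kac_regular and of their first     *)
(* order derivatives are controlled by the norms on [0, t] of the potential *)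
(* and of its derivative.                                                   *)
Definition feynman_kac_bounds (R : realType)
    (E : completePseudoMetricType R)
    (K : R -> R.-pker borel E ~> skorokhod E (+oo%E : \bar R))
    (D : set (E -> R)) (L : R -> (E -> R) -> E -> R) : Prop :=
  forall (t a : R) f, 0 <= t -> D f -> exists c : R,
    forall U U', potential D U -> C1 D `[0, +oo[ U U' ->
    (forall r, 0 <= r <= t -> sup_norm (U r) <= a /\ sup_norm (U' r) <= a) ->
    forall s, 0 <= s <= t ->
    let q := feynman_kac K U s t f in
    let g := fun r => L r (fun x => q x ^+ 2) in
    let h := fun r => L r (L r (fun x => q x ^+ 2)) in
    exists g' h', [/\ C1 D `[0, s] g g', C1 D `[0, s] h h'
      & forall r, 0 <= r <= s ->
          [/\ sup_norm (g r) <= c, sup_norm (g' r) <= c,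
              sup_norm (h r) <= c & sup_norm (h' r) <= c]].

(* Usual augmentation (right-continuous, containing the P-null events) of   *)
(* the filtration of the canonical process.                                 *)
Definition augmented_filtration (R : realType)
    (E : completePseudoMetricType R)
    (P : probability (skorokhod E +oo%E) R) (t : R) :
    set (set (skorokhod E +oo%E)) :=
  [set A | measurable A /\ forall s, t < s ->
     exists B, sigma_coordinates `[0, s] B /\ P (A `+` B) = 0%E].

Definition martingale (R : realType) (E : completePseudoMetricType R)
    (P : probability (skorokhod E +oo%E) R)
    (M : R -> skorokhod E (+oo%E : \bar R) -> R) : Prop :=
  [/\ forall t (B : set R), 0 <= t -> measurable B ->
        augmented_filtration P t (M t @^-1` B),
      forall t, 0 <= t -> P.-integrable setT (EFin \o M t)
    & forall s t A, 0 <= s <= t -> augmented_filtration P s A ->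
        \int[P]_(w in A) M t w = \int[P]_(w in A) M s w].

Definition carre_du_champ (R : realType) (E : Type)
    (L : (E -> R) -> E -> R) (f : E -> R) (x : E) : R :=
  L (fun y => (f y - f x) ^+ 2) x.

Definition integrable_along (R : realType) (E : completePseudoMetricType R)
    (P : probability (skorokhod E +oo%E) R) (b : R -> E -> R) : Prop :=
  forall t : R, 0 <= t ->
    (@lebesgue_measure R \x P)%E.-integrable
      ((`[0, t] : set R) `*` [set: skorokhod E +oo%E])
      (fun z : R * skorokhod E (+oo%E : \bar R) => (b z.1 (z.2 z.1))%:E).

(* df_t(X_t) = (\partial_t + L_t)(f_t)(X_t) dt + dM_t(f) with a martingale  *)
(* M(f) such that d<M(f)>_t = Gamma_{L_t}(f_t, f_t)(X_t) dt.                *)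
Definition stochastic_calculus (R : realType)
    (E : completePseudoMetricType R)
    (P : probability (skorokhod E +oo%E) R)
    (D : set (E -> R)) (L : R -> (E -> R) -> E -> R) : Prop :=
  forall f f', C1 D `[0, +oo[ f f' ->
    let b s x := f' s x + L s (f s) x in
    let G s x := carre_du_champ (L s) (f s) x in
    let M t (w : skorokhod E (+oo%E : \bar R)) :=
      f t (w t) - f 0 (w 0)
      - \int[lebesgue_measure]_(s in `[0, t]) b s (w s) in
    [/\ integrable_along P b, integrable_along P G, martingale P M
      & martingale P (fun t w =>
          M t w ^+ 2 - \int[lebesgue_measure]_(s in `[0, t]) G s (w s))].

Record continuous_case (R : realType) (E : completePseudoMetricType R)
    (P : probability (skorokhod E +oo%E) R)
    (K : R -> R.-pker borel E ~> skorokhod E (+oo%E : \bar R))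
    (D : set (E -> R)) (L : R -> (E -> R) -> E -> R)
    (V : R -> E -> R) : Prop := ContinuousCase {
  continuous_case_subalgebra : bounded_subalgebra D ;
  continuous_case_generates : generates_borel D ;
  continuous_case_markov : markov_process K P ;
  continuous_case_generators : generators K D L ;
  continuous_case_potential : exists V', C1 D `[0, +oo[ V V' ;
  continuous_case_regular : feynman_kac_regular K D L ;
  continuous_case_bounds : feynman_kac_bounds K D L ;
  continuous_case_calculus : stochastic_calculus P D L }.

(* Main.v *)
Require Import Defs.
From mathcomp Require Import all_boot all_order all_algebra.
From mathcomp Require Import ring lra zify.
From mathcomp Require Import all_classical all_reals all_analysis.
From mathcomp Require Import measurable_realfun.

Set Implicit Arguments.
Unset Strict Implicit.
Unset Printing Implicit Defensive.

Import Order.TTheory GRing.Theory Num.Theory.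
Import numFieldNormedType.Exports.

Local Open Scope classical_set_scope.
Local Open Scope ring_scope.

(* In part (1), V is constant along step paths on each cell of the mesh, so    *)
(* the Riemann sum of V along the path is the integral.                        *)
(* In part (2), the densities of Lambda_t and of its approximation with        *)
(* respect to the law of the path are exp S and exp S_m, where S is the        *)
(* integral of V_s(X_s) over [0, t] and S_m is its Riemann sum. As S and S_m   *)
(* are bounded uniformly in m, it suffices to prove E|S_m - S| = O(1/m). On a  *)
(* cell [u, v] of length 1/m, the stochastic calculus for (v - s) V_s yields   *)
(*   \int_u^v V_s(X_s) ds - V_u(X_u) / m                                       *)
(*     = (N_v - N_u) + \int_u^v (v - s) (\partial_s + L_s)(V_s)(X_s) ds        *)
(* for a martingale N. The drift terms sum to O(1/m). The martingale           *)
(* increments of distinct cells are orthogonal, and their second moments are   *)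
(* at most m^-2 E \int_u^v |Gamma_{L_s}(V_s, V_s)(X_s)| ds, hence their sum    *)
(* is O(1/m) in L^2.                                                           *)

(** * Bounded functionals and charges with a density *)

(** Both path measures are images under [stop_path] of measures with densities [exp S_m] and [exp S]
    with respect to [P]. The remainders are therefore images of charges with density
    [m (exp S_m - exp S)], respectively [m (exp S_m / E exp S_m - exp S / E exp S)], and their total
    variation is at most the L1 norm of that density ([charge_density]). [charge_first_order]
    reduces both bounds to an O(1/m) estimate of [E |exp S_m - exp S|], and local boundedness of [V]
    with [expR_lipschitz] reduces this to [riemann_sum_error].

    Adding the cell errors by the triangle inequality would only give the rate m^(-1/2), because of
    the martingale fluctuation inside each cell. The gain comes from orthogonality: the weight (v -
    s), which vanishes at the end v of a cell, turns the cell error into an increment of a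
    martingale [N v] plus a drift. Increments of distinct cells are orthogonal
    ([martingale_orthogonal]), so their sum has second moment O(m^-2) ([Z_sqr_le]), while the drift
    is bounded path by path ([Z_euler]).

    Integral identities rest on [bounded_functional_eq0], used once to evaluate [charge_integral]
    and once to extend a vanishing conditional expectation from events to functions.

    In case (D) both exponents reduce, along a step path, to the sum of [ln (G k)] over k < n. The
    real work there is measurability: the joint measurability of (s, w) -> w s, deduced from right
    continuity, allows the integrals to be transported to the chain. *)

Lemma bounded_funEx (R : realType) (T : Type) (f : T -> R) :
  bounded_fun f <-> exists c : R, forall x, `|f x| <= c.
Proof.
split=> [[c [_ cf]]|[c cf]].
  by exists (c + 1) => x; apply: cf => //; rewrite ltrDl.
exists c; split; first exact: num_real.
by move=> M cM x _ /=; rewrite (le_trans (cf x))// ltW.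
Qed.

Lemma bounded_measurable_integrable (R : realType) (d : measure_display)
    (T : measurableType d) (P : {finite_measure set T -> \bar R})
    (f : T -> R) : bounded_measurable f -> P.-integrable setT (EFin \o f).
Proof.
move=> [mf bf]; apply: measurable_bounded_integrable => //.
by rewrite -ge0_fin_numE// fin_num_measure.
Qed.

Lemma bounded_measurable_indic (R : realType) (d : measure_display)
    (T : measurableType d) (A : set T) :
  measurable A -> bounded_measurable (\1_A : T -> R).
Proof.
move=> mA; split; first exact: measurable_indic.
by apply/bounded_funEx; exists 1 => x; rewrite indicE ger0_norm// lern1 leq_b1.
Qed.

Lemma bounded_measurable_cst (R : realType) (d : measure_display)
    (T : measurableType d) (a : R) : bounded_measurable ((fun=> a) : T -> R).
Proof.
by split; [exact: measurable_cst|apply/bounded_funEx; exists `|a|].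
Qed.

Lemma bounded_measurable_lin (R : realType) (d : measure_display)
    (T : measurableType d) (a : R) (f g : T -> R) :
  bounded_measurable f -> bounded_measurable g ->
  bounded_measurable (fun x => a * f x + g x).
Proof.
move=> [mf /bounded_funEx[c cf]] [mg /bounded_funEx[c' cg]]; split.
  by apply: measurable_funD => //; apply: measurable_funM.
apply/bounded_funEx; exists (`|a| * c + c') => x.
by rewrite (le_trans (ler_normD _ _))// lerD// normrM ler_wpM2l.
Qed.

Lemma bounded_measurableM (R : realType) (d : measure_display)
    (T : measurableType d) (f g : T -> R) :
  bounded_measurable f -> bounded_measurable g ->
  bounded_measurable (fun x => f x * g x).
Proof.
move=> [mf /bounded_funEx[c cf]] [mg /bounded_funEx[c' cg]]; split.
  exact: measurable_funM.
by apply/bounded_funEx; exists (c * c') => x; rewrite normrM ler_pM.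
Qed.

(* A bounded function f >= 0 is within 1/k of the simple function             *)
(* \sum_j k^-1 1{j + 1 <= k f}.                                               *)
Lemma bounded_functional_eq0 (R : realType) (d : measure_display)
    (T : measurableType d) (I : (T -> R) -> R) (c : R) :
  (forall a f g, bounded_measurable f -> bounded_measurable g ->
    I (fun x => a * f x + g x) = a * I f + I g) ->
  (forall f e, bounded_measurable f -> (forall x, `|f x| <= e) ->
    `|I f| <= c * e) ->
  (forall A, measurable A -> I (\1_A) = 0) ->
  forall f, bounded_measurable f -> I f = 0.
Proof.
move=> Ilin Ibnd I1 f bmf.
have bm0 : bounded_measurable ((fun=> 0) : T -> R) by exact: bounded_measurable_cst.
have I0 : I (fun=> 0) = 0 by rewrite -[RHS](I1 set0)// indic0.
have c0 : 0 <= c.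
  have := Ibnd _ 1 bm0; rewrite I0 normr0 mulr1; apply => x.
  exact: ler01.
case: (bmf) => mf /bounded_funEx[M Mf].
have [[x0 _]|T0] := pselect (exists x : T, True); last first.
  rewrite -[RHS]I0; congr I; apply/funext => x; exfalso; apply: T0.
  by exists x.
have M0 : 0 <= M by exact: le_trans (Mf x0).
(* Adding the constant [M] makes the function nonnegative without changing the value of [I], which
   vanishes on the indicator of the whole space. *)
pose g x := M * \1_[set: T] x + f x.
have bm1 : bounded_measurable (\1_[set: T] : T -> R).
  exact: bounded_measurable_indic.
have bmg : bounded_measurable g by exact: bounded_measurable_lin.
have Ig : I g = I f by rewrite /g Ilin// I1// mulr0 add0r.
have g0 x : 0 <= g x <= M + M.
  rewrite /g indicT mulr1; have := Mf x; rewrite ler_norml => /andP[]; lra.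
suff gk k : `|I f| <= c * (k.+1%:R)^-1.
  apply/eqP; rewrite -normr_le0; apply/ler_addgt0Pl => e e0; rewrite addr0.
  have [c00|cn0] := eqVneq c 0.
    by rewrite (le_trans (gk 0%N))// c00 mul0r ltW.
  have c1 : 0 < c by rewrite lt0r cn0.
  apply: le_trans (gk (Num.truncn (c / e))) _.
  rewrite ler_pdivrMr ?ltr0n// mulrC -ler_pdivrMr//.
  by rewrite ltW// truncnS_gt.
pose A j := [set x | j.+1%:R <= k.+1%:R * g x].
have mA j : measurable (A j).
  rewrite -[A j]setTI.
  have -> : A j = (fun x => k.+1%:R * g x) @^-1` `[j.+1%:R, +oo[%classic.
    by apply/seteqP; split => x /=; rewrite in_itv/= andbT.
  have : measurable_fun setT (fun x => k.+1%:R * g x).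
    by apply: measurable_funM => //; case: bmg.
  by apply.
pose S N x : R := \sum_(j < N) (k.+1%:R^-1 * \1_(A j) x).
have bmS N : bounded_measurable (S N) /\ I (S N) = 0.
  elim: N => [|N [IHb IH0]].
    have -> : S 0%N = fun=> 0 by apply/funext => x; rewrite /S big_ord0.
    by [].
  have -> : S N.+1 = fun x => k.+1%:R^-1 * \1_(A N) x + S N x.
    by apply/funext => x; rewrite /S big_ord_recr/= addrC.
  have bA := @bounded_measurable_indic R _ _ _ (mA N).
  by split; [exact: bounded_measurable_lin|rewrite Ilin// IH0 I1// mulr0 addr0].
(* [N] bounds the integer part of [k.+1 * g x] for every x, so no level is missed and [S N x] is
   exactly that integer part divided by [k.+1]. *)
pose N := Num.truncn (k.+1%:R * (M + M)).
have [bS IS] := bmS N.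
have -> : I f = I (fun x => (-1) * S N x + g x).
  by rewrite Ilin// IS mulr0 add0r Ig.
apply: Ibnd; first exact: bounded_measurable_lin.
move=> x; set y := k.+1%:R * g x.
have k0 : 0 < k.+1%:R :> R by rewrite ltr0n.
have y0 : 0 <= y by rewrite mulr_ge0 ?ler0n//; case/andP: (g0 x).
have tN : (Num.truncn y <= N)%N.
  apply: le_truncn; rewrite /y ler_pM2l//; by case/andP: (g0 x).
have SE : S N x = k.+1%:R^-1 * (Num.truncn y)%:R.
  rewrite /S -mulr_sumr; congr (_ * _).
  transitivity ((\sum_(j < N) (j < Num.truncn y))%N%:R : R).
    rewrite natr_sum; apply: eq_bigr => j _; rewrite indicE; congr (_%:R).
    rewrite truncn_ge_nat//; congr nat_of_bool.
    by apply/idP/idP; [move=> /set_mem|move=> ?; apply/mem_set].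
  congr (_%:R).
  suff -> : (\sum_(j < N) (j < Num.truncn y))%N = minn N (Num.truncn y) by exact/minn_idPr.
  elim: (N) => [|n IH]; first by rewrite big_ord0 min0n.
  by rewrite big_ord_recr/= IH; lia.
have -> : -1 * S N x + g x = k.+1%:R^-1 * (y - (Num.truncn y)%:R).
  by rewrite SE /y mulrBr mulKf ?gt_eqF//; ring.
have /andP[ty yt] := truncn_itv y0.
rewrite normrM gtr0_norm ?invr_gt0// ler_piMr// ?invr_ge0 ?ltW//.
by rewrite ger0_norm ?subr_ge0//; move: yt; rewrite -natr1; lra.
Qed.

Lemma Rintegral_lin (R : realType) (d : measure_display)
    (T : measurableType d) (mu : {measure set T -> \bar R}) (a : R)
    (f g : T -> R) :
  mu.-integrable setT (EFin \o f) -> mu.-integrable setT (EFin \o g) ->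
  \int[mu]_w (a * f w + g w) = a * \int[mu]_w f w + \int[mu]_w g w.
Proof.
move=> fi gi; rewrite RintegralD ?RintegralZl//.
exact: (integrableZl measurableT a fi).
Qed.

(** The charge is the image under [phi] of the charge with density [W]. The two sides of the
    integral formula differ by a linear functional of f, continuous for the uniform norm and zero on
    indicators by the Jordan decomposition, hence zero by [bounded_functional_eq0]. *)
Lemma charge_density (R : realType) (d d' : measure_display)
    (T : measurableType d) (T' : measurableType d')
    (P : {measure set T -> \bar R}) (phi : T -> T') (W : T -> R) :
  measurable_fun setT phi -> P.-integrable setT (EFin \o W) ->
  exists r : {charge set T' -> \bar R},
    (forall f, bounded_measurable f ->
      charge_integral r f = \int[P]_w (f (phi w) * W w)) /\
    (tv_norm r <= (\int[P]_w `|W w|)%:E)%E.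
Proof.
move=> mphi iW.
pose r0 : {charge set T -> \bar R} := induced_charge iW.
pose r1 : {charge set T' -> \bar R} := pushforward r0 phi.
pose r := r1 mphi.
have ifW f : bounded_measurable f ->
    P.-integrable setT (EFin \o (fun w => f (phi w) * W w)).
  move=> [mf /bounded_funEx[c cf]].
  apply: (integrableMr measurableT _ _ iW); first exact: measurableT_comp.
  by apply/bounded_funEx; exists c.
have rE f : bounded_measurable f ->
    charge_integral r f = \int[P]_w (f (phi w) * W w).
  move=> bmf; apply/eqP; rewrite -subr_eq0; apply/eqP; move: f bmf.
  rewrite /charge_integral; set hP := svalP _; set hPN := svalP _.
  set p := jordan_pos hPN; set n := jordan_neg hPN.
  have ip f : bounded_measurable f -> p.-integrable setT (EFin \o f).
    exact: bounded_measurable_integrable.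
  have inn f : bounded_measurable f -> n.-integrable setT (EFin \o f).
    exact: bounded_measurable_integrable.
  have mle (m : {finite_measure set T' -> \bar R}) f e :
      bounded_measurable f -> (forall x, `|f x| <= e) ->
      `|\int[m]_x f x| <= fine (m setT) * e.
    move=> bmf fe; have im := @bounded_measurable_integrable _ _ _ m _ bmf.
    rewrite (le_trans (le_normr_Rintegral _ im))// mulrC.
    rewrite -Rintegral_cst//; apply: le_Rintegral => //.
      exact: integrable_norm im.
    exact: finite_measure_integrable_cst.
  apply: (@bounded_functional_eq0 _ _ _ _
    (fine (p setT) + fine (n setT) + \int[P]_w `|W w|)).
  - move=> a f g bf bg.
    have -> : (fun w => (a * f (phi w) + g (phi w)) * W w) =
        (fun w => a * (f (phi w) * W w) + g (phi w) * W w).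
      by apply/funext => w; ring.
    rewrite (Rintegral_lin _ (ip _ bf) (ip _ bg)).
    rewrite (Rintegral_lin _ (inn _ bf) (inn _ bg)).
    by rewrite (Rintegral_lin _ (ifW _ bf) (ifW _ bg)); ring.
  - move=> f e bf fe; rewrite 2!mulrDl.
    rewrite (le_trans (ler_normB _ _))// lerD//.
      by rewrite (le_trans (ler_normB _ _))// lerD// mle.
    rewrite (le_trans (le_normr_Rintegral _ (ifW _ bf)))//.
    rewrite -RintegralZr//; last exact: integrable_norm.
    apply: le_Rintegral => //; first exact: integrable_norm (ifW _ bf).
      by apply: (integrableZr measurableT e (integrable_norm iW)).
    by move=> w _; rewrite normrM mulrC ler_wpM2l.
  - move=> A mA.
    have mI (m : {measure set T' -> \bar R}) :
        \int[m]_x (\1_A x : R) = fine (m A).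
      by rewrite /Rintegral integral_indic// setIT.
    rewrite !mI; have := jordan_decomp hPN mA.
    have -> : \int[P]_w (\1_A (phi w) * W w) = fine (r A).
      rewrite /r/= /pushforward/= /induced_charge.
      rewrite [in RHS]integral_mkcond; congr fine; apply: eq_integral => w _.
      rewrite /restrict/= indicE.
      have -> : (w \in phi @^-1` A) = (phi w \in A).
        by apply/idP/idP => /set_mem ?; apply/mem_set.
      by case: ifP => _; rewrite ?mul1r ?mul0r.
    move=> ->; rewrite /cadd/= cscaleN1 fineD ?fin_numN ?fin_num_measure//.
    by rewrite fineN subrr.
exists r; split => //.
apply: ge_ereal_sup => _ [f [mf f1] <-].
have bf : bounded_measurable f.
  by split => //; apply/bounded_funEx; exists 1.
rewrite lee_fin rE// (le_trans (le_normr_Rintegral _ (ifW _ bf)))//.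
apply: le_Rintegral => //; first exact: integrable_norm (ifW _ bf).
  exact: integrable_norm.
by move=> w _; rewrite normrM ler_piMl.
Qed.

(** * Orthogonality of martingale increments *)

Lemma integrable_EFinZl (R : realType) (d : measure_display)
    (T : measurableType d) (P : {measure set T -> \bar R}) (A : set T) (a : R)
    (f : T -> R) : measurable A -> P.-integrable A (EFin \o f) ->
  P.-integrable A (EFin \o (fun w => a * f w)).
Proof. by move=> mA fi; exact: (integrableZl mA a fi). Qed.

(** The last hypothesis says that the conditional expectation of Y given Z is zero. It passes to
    g(Z) for bounded g by [bounded_functional_eq0], then to Z itself by truncation and dominated
    convergence. *)
Lemma Rintegral_preimage_eq0 (R : realType) (d : measure_display)
    (T : measurableType d) (P : {measure set T -> \bar R}) (Y Z : T -> R) :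
  measurable_fun setT Z -> P.-integrable setT (EFin \o Y) ->
  P.-integrable setT (EFin \o (fun w => Z w * Y w)) ->
  (forall B : set R, measurable B -> \int[P]_(w in Z @^-1` B) Y w = 0) ->
  \int[P]_w (Z w * Y w) = 0.
Proof.
move=> mZ iY iZY ZY0.
have igY (g : R -> R) : bounded_measurable g ->
    P.-integrable setT (EFin \o (fun w => g (Z w) * Y w)).
  move=> [mg /bounded_funEx[c cg]].
  apply: (integrableMr measurableT _ _ iY); first exact: measurableT_comp.
  by apply/bounded_funEx; exists c.
have gY0 (g : R -> R) : bounded_measurable g -> \int[P]_w (g (Z w) * Y w) = 0.
  move: g; apply: (@bounded_functional_eq0 _ _ _ _ (\int[P]_w `|Y w|)).
  - move=> a f g bf bg.
    rewrite -(Rintegral_lin _ (igY _ bf) (igY _ bg)); congr Rintegral.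
    by apply/funext => w; ring.
  - move=> f e bf fe.
    rewrite (le_trans (le_normr_Rintegral _ (igY _ bf)))//.
    rewrite -RintegralZr//; last exact: integrable_norm.
    apply: le_Rintegral => //; first exact: integrable_norm (igY _ bf).
      by apply: (integrableZr measurableT e (integrable_norm iY)).
    by move=> w _; rewrite normrM mulrC ler_wpM2l.
  - move=> A mA; rewrite -[RHS](ZY0 A)// [RHS]Rintegral_mkcond.
    congr Rintegral; apply/funext => w; rewrite /restrict/= indicE.
    have -> : (w \in Z @^-1` A) = (Z w \in A).
      by apply/idP/idP => /set_mem ?; apply/mem_set.
    by case: ifP => _; rewrite ?mul1r ?mul0r.
(* Truncation at level N: bounded, dominated by the identity, and eventually equal to it at each
   point. *)
pose g (N : nat) (x : R) := x * \1_[set x | `|x| <= N%:R] x.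
have bg N : bounded_measurable (g N).
  split.
    apply: measurable_funM => //; apply: measurable_indic.
    have -> : [set x : R | `|x| <= N%:R] = `[- N%:R, N%:R]%classic.
      by apply/seteqP; split => x /=; rewrite in_itv/= ler_norml.
    exact: measurable_itv.
  apply/bounded_funEx; exists N%:R => x; rewrite /g normrM indicE.
  case: (boolP (_ \in _)) => [/set_mem/= xN|_]; first by rewrite normr1 mulr1.
  by rewrite normr0 mulr0.
have [||_ _ /cvg_lim] := @dominated_convergence _ _ _ P setT measurableT
  (fun N w => (g N (Z w) * Y w)%:E) (fun w => (Z w * Y w)%:E)
  (fun w => `|Z w * Y w|%:E) (fun N => measurable_int P (igY _ (bg N)))
  (measurable_int P iZY) _ (integrable_norm iZY).
- apply: aeW => w _ /=; apply: cvg_near_cst.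
  near=> N; congr (_%:E); congr (_ * _).
  rewrite /g indicE mem_set ?mulr1//=.
  by near: N; exact: nbhs_infty_ger.
- apply: aeW => w N _ /=; rewrite lee_fin !normrM ler_wpM2r//.
  rewrite indicE; case: (_ \in _); first by rewrite normr1 mulr1.
  by rewrite normr0 mulr0.
rewrite /Rintegral => <-//.
rewrite [X in lim (X @ _)](_ : _ = cst 0%E) ?lim_cst//.
apply/funext => n /=; rewrite -[LHS]fineK ?integrable_fin_num//; last exact: igY.
by rewrite -/(Rintegral P setT (fun w => g n (Z w) * Y w)) gY0.
Unshelve. all: by end_near. Qed.

Lemma integrable_mul_sqr (R : realType) (d : measure_display)
    (T : measurableType d) (P : {measure set T -> \bar R}) (f g : T -> R) :
  measurable_fun setT f -> measurable_fun setT g ->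
  P.-integrable setT (EFin \o (fun w => f w ^+ 2)) ->
  P.-integrable setT (EFin \o (fun w => g w ^+ 2)) ->
  P.-integrable setT (EFin \o (fun w => f w * g w)).
Proof.
move=> mf mg fi gi; apply: (le_integrable measurableT _ _ (integrableD measurableT fi gi)).
  exact/measurable_EFinP/measurable_funM.
move=> w _ /=; rewrite lee_fin [leRHS]ger0_norm ?addr_ge0 ?sqr_ge0//.
rewrite -[f w ^+ 2]real_normK ?num_real// -[g w ^+ 2]real_normK ?num_real//.
rewrite normrM; set a := `|f w|; set b := `|g w|.
have := sqr_ge0 (a - b); have : 0 <= a * b by rewrite mulr_ge0 ?normr_ge0.
by rewrite sqrrB; lra.
Qed.

Lemma integrable_sqrD (R : realType) (d : measure_display)
    (T : measurableType d) (P : {measure set T -> \bar R}) (f g : T -> R) :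
  measurable_fun setT f -> measurable_fun setT g ->
  P.-integrable setT (EFin \o (fun w => f w ^+ 2)) ->
  P.-integrable setT (EFin \o (fun w => g w ^+ 2)) ->
  P.-integrable setT (EFin \o (fun w => (f w + g w) ^+ 2)).
Proof.
move=> mf mg fi gi.
have := integrableD measurableT (integrableD measurableT fi gi)
  (integrableZl measurableT 2 (integrable_mul_sqr mf mg fi gi)).
by apply: eq_integrable => // w _; rewrite /= -!(EFinD, EFinM); congr (_%:E); ring.
Qed.

(** Fubini for a function given on [A] times the whole space, through its extension by zero. It
    serves for time integrals along the path, which make sense for almost every path only. *)
Lemma integrable_prod_section (R : realType) (d1 d2 : measure_display)
    (T1 : measurableType d1) (T2 : measurableType d2)
    (m1 : {sigma_finite_measure set T1 -> \bar R})
    (m2 : {sigma_finite_measure set T2 -> \bar R})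
    (A : set T1) (F : T1 -> T2 -> R) :
  measurable A ->
  (m1 \x m2)%E.-integrable (A `*` setT) (fun z => (F z.1 z.2)%:E) ->
  m2.-integrable setT (EFin \o (fun y => \int[m1]_(x in A) F x y)) /\
  {ae m2, forall y, m1.-integrable A (EFin \o F^~ y)}.
Proof.
move=> mA iF.
have mAT : measurable (A `*` [set: T2]) by exact: measurableX.
pose f := (fun z : T1 * T2 => (F z.1 z.2)%:E) \_ (A `*` setT).
have if1 : (m1 \x m2)%E.-integrable setT f by apply/(integrable_mkcond _ mAT).
have mf := measurable_int _ if1.
have fE y : (fun x => f (x, y)) = (fun x => (F x y)%:E) \_ A.
  apply/funext => x; rewrite /f /restrict.
  suff -> : ((x, y) \in A `*` [set: T2]) = (x \in A) by [].
  by rewrite in_setX in_setT andbT.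
split; last first.
  apply: filterS (ae_integrable2 if1) => y iy.
  by apply/integrable_mkcond => //; rewrite -fE.
have GE y : fubini_G m1 f y = (\int[m1]_(x in A) (F x y)%:E)%E.
  by rewrite [RHS]integral_mkcond -fE.
have mG := measurable_fubini_G if1.
have mabs : measurable_fun setT (fun y => \int[m1]_x `|f (x, y)|)%E.
  apply: (measurable_fun_fubini_tonelli_G (abse \o f)) => //=.
  exact: measurableT_comp.
have iabs : m2.-integrable setT (fun y => \int[m1]_x `|f (x, y)|)%E.
  apply/integrableP; split => //.
  have := (integrable21ltyP m1 m2 mf).1 if1; apply: le_lt_trans.
  apply: ge0_le_integral => //; first exact: measurableT_comp.
  by move=> y _; rewrite gee0_abs//; exact: integral_ge0.
have mRI : measurable_fun setT (EFin \o (fun y => \int[m1]_(x in A) F x y)).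
  apply/measurable_EFinP; rewrite /Rintegral.
  under eq_fun do rewrite -GE.
  exact: measurableT_comp.
apply: (le_integrable measurableT mRI _ iabs) => y _ /=.
rewrite [leRHS]gee0_abs; last exact: integral_ge0.
rewrite /Rintegral -GE.
(* Where the section integral is infinite, [fine] returns 0, so the inequality persists on the
   exceptional set. *)
apply: (@le_trans _ _ `|fubini_G m1 f y|%E).
  by case: (fubini_G m1 f y) => [r| |] /=; rewrite ?normr0 ?leey ?lexx.
apply: le_abse_integral => //.
exact: (measurableT_comp mf (measurable_pair2 y)).
Qed.

(** [M s] is measurable at time s and the later increment of [N] has zero mean on every event of
    that time. The martingales M and N may differ: the increments of distinct cells come from
    distinct martingales. *)
Lemma martingale_orthogonal (R : realType) (E : completePseudoMetricType R)
    (P : probability (skorokhod E +oo%E) R)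
    (M N : R -> skorokhod E (+oo%E : \bar R) -> R) (s u v : R) :
  martingale P M -> martingale P N -> 0 <= s <= u -> u <= v ->
  P.-integrable setT (EFin \o (fun w => M s w ^+ 2)) ->
  P.-integrable setT (EFin \o (fun w => N u w ^+ 2)) ->
  P.-integrable setT (EFin \o (fun w => N v w ^+ 2)) ->
  \int[P]_w (M s w * (N v w - N u w)) = 0.
Proof.
move=> [Mad iM Mm] [Nad iN Nm] /andP[s0 su] uv M2 Nu2 Nv2.
have u0 := le_trans s0 su; have v0 := le_trans u0 uv.
have mreal (X : R -> skorokhod E (+oo%E : \bar R) -> R) t :
    P.-integrable setT (EFin \o X t) -> measurable_fun setT (X t).
  by move=> /measurable_int/measurable_EFinP.
have mM := mreal _ _ (iM _ s0); have mNu := mreal _ _ (iN _ u0).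
have mNv := mreal _ _ (iN _ v0).
apply: Rintegral_preimage_eq0 => //.
- exact: (integrableB measurableT (iN _ v0) (iN _ u0)).
- under [X in _.-integrable _ X]eq_fun do rewrite /= mulrBr EFinB.
  by apply: (integrableB measurableT); exact: integrable_mul_sqr.
- move=> B mB; have AF := Mad s B s0 mB.
  have mA : measurable (M s @^-1` B) by case: AF.
  rewrite RintegralB//; last 2 first.
  + exact: integrableS (iN _ v0).
  + exact: integrableS (iN _ u0).
  by rewrite (Nm s v)// ?s0 ?(le_trans su)// (Nm s u) ?subrr ?s0.
Qed.

(** * Functions of class C1 in time *)

Lemma uniform_cvg_ballP (R : realType) (T : choiceType) (F : set_system R)
    (FF : Filter F) (h : R -> T -> R) (f : T -> R) :
  {uniform, h @ F --> f} <->
  forall e, 0 < e -> \forall s \near F, forall x, `|h s x - f x| < e.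
Proof.
split=> [hf e e0|hf P /uniform_nbhs[A [entA AP]]].
  have := hf [set g | forall x, `|g x - f x| < e]; apply.
  apply/uniform_nbhs; exists [set ab | ball ab.1 e ab.2].
  split; first exact: entourage_ball (PosNum e0).
  by move=> g /= gf x; rewrite distrC; exact: gf.
move: entA; rewrite -entourage_ballE => -[e /= e0 eA].
apply: filterS (hf e e0) => s hs; apply: AP => x _.
by apply: eA; rewrite /ball/= distrC.
Qed.

Lemma C1_derive_near (R : realType) (E : completePseudoMetricType R)
    (D : set (E -> R)) (J : set R) (f f' : R -> E -> R) (t : R) :
  C1 D J f f' -> J t -> forall e, 0 < e -> \forall s \near t, s != t -> J s ->
    forall x, `|(s - t)^-1 * (f s x - f t x) - f' t x| < e.
Proof.
move=> fC Jt e e0; have [_ _ /uniform_cvg_ballP fd _] := fC t Jt.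
exact: fd e e0.
Qed.

Lemma C1_derive_continuous (R : realType) (E : completePseudoMetricType R)
    (D : set (E -> R)) (J : set R) (f f' : R -> E -> R) (t : R) :
  C1 D J f f' -> J t -> forall e, 0 < e -> \forall s \near t, J s ->
    forall x, `|f' s x - f' t x| < e.
Proof.
move=> fC Jt e e0; have [_ _ _ /uniform_cvg_ballP fd] := fC t Jt.
exact: fd e e0.
Qed.

Lemma C1_continuous (R : realType) (E : completePseudoMetricType R)
    (D : set (E -> R)) (J : set R) (f f' : R -> E -> R) (t : R) :
  (forall g, D g -> bounded_measurable (g : borel E -> R)) ->
  C1 D J f f' -> J t -> forall e, 0 < e -> \forall s \near t, J s ->
    forall x, `|f s x - f t x| < e.
Proof.
move=> Db fC Jt e e0; have [Df Df' _ _] := fC t Jt.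
have [_ /bounded_funEx[c cf']] := Db _ Df'.
have c0 : 0 <= c by exact: le_trans (cf' point).
have d0 : 0 < e / (c + 1) by rewrite divr_gt0// ltr_wpDl.
near=> s => Js x.
have fd : s != t -> J s -> forall x,
    `|(s - t)^-1 * (f s x - f t x) - f' t x| < 1.
  by near: s; exact: C1_derive_near fC Jt _ ltr01.
have std : `|s - t| < e / (c + 1).
  by rewrite distrC; near: s; exact: (nbhsx_ballx t _ d0).
have [->|st] := eqVneq s t; first by rewrite subrr normr0.
have -> : f s x - f t x = (s - t) * ((s - t)^-1 * (f s x - f t x)).
  by rewrite mulVKf// subr_eq0.
rewrite normrM.
have q1 : `|(s - t)^-1 * (f s x - f t x)| <= c + 1.
  rewrite -[X in `|X|](subrK (f' t x)) (le_trans (ler_normD _ _))// addrC.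
  by rewrite lerD// ltW// fd.
apply: (le_lt_trans (ler_wpM2l (normr_ge0 _) q1)).
by rewrite -ltr_pdivlMr ?ltr_wpDl.
Unshelve. all: by end_near. Qed.

(** Near each time, f stays within 1 of a bounded function, uniformly in x; compactness of [0, T]
    makes the local bounds global. *)
Lemma C1_bounded (R : realType) (E : completePseudoMetricType R)
    (D : set (E -> R)) (f f' : R -> E -> R) (T : R) :
  (forall g, D g -> bounded_measurable (g : borel E -> R)) ->
  C1 D `[0, +oo[ f f' ->
  exists K : R, forall s x, 0 <= s <= T -> `|f s x| <= K.
Proof.
move=> Db fC.
have /compact_near_coveringP/(_ R +oo%R
    (fun i s => 0 <= s <= T -> forall x, `|f s x| <= i) _) h :=
  @segment_compact R 0 T.
have : \forall i \near +oo%R, `[0, T]%classic `<=`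
    (fun s => 0 <= s <= T -> forall x, `|f s x| <= i).
  apply: h => t /=; rewrite in_itv/= => /andP[t0 tT].
  have Jt : `[0, +oo[%classic t by rewrite /= in_itv/= t0.
  have [Df _ _ _] := fC t Jt; have [_ /bounded_funEx[c cf]] := Db _ Df.
  exists ([set s | `[0, +oo[%classic s -> forall x, `|f s x - f t x| < 1],
          [set i | c + 1 <= i]).
    split; first exact: (C1_continuous Db fC Jt ltr01).
    exact: nbhs_pinfty_ge (num_real _).
  move=> [s i] [/= fs ci] /andP[s0 sT] x.
  have -> : f s x = f t x + (f s x - f t x) by ring.
  rewrite (le_trans (ler_normD _ _))// (@le_trans _ _ (c + 1))//.
  by rewrite lerD// ltW// fs// in_itv/= s0.
move=> [K [_ KP]]; exists (K + 1) => s x sT.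
by apply: (KP (K + 1)) => //; rewrite ?ltrDl//= in_itv.
Qed.

(** The product rule that makes (v - s) [V s] admissible in the stochastic calculus. *)
Lemma C1_affineM (R : realType) (E : completePseudoMetricType R)
    (D : set (E -> R)) (J : set R) (f f' : R -> E -> R) (v : R) :
  bounded_subalgebra D -> C1 D J f f' ->
  C1 D J (fun s x => (v - s) * f s x) (fun s x => (v - s) * f' s x - f s x).
Proof.
move=> [Db D1 Dlin _] fC t Jt.
have [Df Df' _ _] := fC t Jt.
have D0 : D (fun=> 0).
  by have := Dlin (-1) _ _ D1 D1; congr D; apply/funext => x; ring.
have [_ /bounded_funEx[c cf']] := Db _ Df'.
have c0 : 0 <= c by exact: le_trans (cf' point).
have c1 : 0 < c + 1 by rewrite ltr_wpDl.
(* [a] bounds |v - s| for all s within distance 1 of t. *)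
pose a := `|v - t| + 1.
have a0 : 0 < a by rewrite ltr_wpDl.
split.
- by have := Dlin (v - t) _ _ Df D0; congr D; apply/funext => x; ring.
- have := Dlin (v - t) _ _ Df' (Dlin (-1) _ _ Df D0).
  by congr D; apply/funext => x; ring.
- apply/uniform_cvg_ballP => e e0.
  have ea : 0 < e / 2 / a by rewrite !divr_gt0.
  have ec : 0 < e / 2 / (c + 1) by rewrite !divr_gt0.
  have : \forall s \near t, s != t -> J s -> forall x,
      `|(s - t)^-1 * ((v - s) * f s x - (v - t) * f t x)
        - ((v - t) * f' t x - f t x)| < e; last by [].
  near=> s => st Js x.
  have fd : s != t -> J s -> forall x,
      `|(s - t)^-1 * (f s x - f t x) - f' t x| < e / 2 / a.
    by near: s; exact: C1_derive_near fC Jt _ ea.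
  have st1 : `|s - t| < 1.
    by rewrite distrC; near: s; exact: (nbhsx_ballx t _ ltr01).
  have std : `|s - t| < e / 2 / (c + 1).
    by rewrite distrC; near: s; exact: (nbhsx_ballx t _ ec).
  have vs : `|v - s| <= a.
    have -> : v - s = (v - t) - (s - t) by ring.
    by rewrite (le_trans (ler_normB _ _))// lerD// ltW.
  have -> : (s - t)^-1 * ((v - s) * f s x - (v - t) * f t x)
        - ((v - t) * f' t x - f t x) =
      (v - s) * ((s - t)^-1 * (f s x - f t x) - f' t x) - (s - t) * f' t x.
    by field; rewrite subr_eq0.
  rewrite (le_lt_trans (ler_normB _ _))// !normrM [ltRHS]splitr ltr_leD//.
    rewrite (@le_lt_trans _ _ (a * `|(s - t)^-1 * (f s x - f t x) - f' t x|))//.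
      exact: ler_wpM2r.
    by rewrite mulrC -ltr_pdivlMr// fd.
  rewrite (@le_trans _ _ (`|s - t| * (c + 1)))//.
    by rewrite ler_wpM2l// (le_trans (cf' x))// lerDl.
  by rewrite -ler_pdivlMr// ltW.
- apply/uniform_cvg_ballP => e e0.
  have ea : 0 < e / 3 / a by rewrite !divr_gt0.
  have ec : 0 < e / 3 / (c + 1) by rewrite !divr_gt0.
  have e3 : 0 < e / 3 by rewrite !divr_gt0.
  have : \forall s \near t, J s -> forall x,
      `|(v - s) * f' s x - f s x - ((v - t) * f' t x - f t x)| < e; last by [].
  near=> s => Js x.
  have fd : J s -> forall x, `|f' s x - f' t x| < e / 3 / a.
    by near: s; exact: C1_derive_continuous fC Jt _ ea.
  have fs : J s -> forall x, `|f s x - f t x| < e / 3.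
    by near: s; exact: C1_continuous Db fC Jt _ e3.
  have st1 : `|s - t| < 1.
    by rewrite distrC; near: s; exact: (nbhsx_ballx t _ ltr01).
  have std : `|s - t| < e / 3 / (c + 1).
    by rewrite distrC; near: s; exact: (nbhsx_ballx t _ ec).
  have vs : `|v - s| <= a.
    have -> : v - s = (v - t) - (s - t) by ring.
    by rewrite (le_trans (ler_normB _ _))// lerD// ltW.
  have -> : (v - s) * f' s x - f s x - ((v - t) * f' t x - f t x) =
      (v - s) * (f' s x - f' t x) - (s - t) * f' t x - (f s x - f t x) by ring.
  have -> : e = e / 3 + e / 3 + e / 3 by field.
  rewrite (le_lt_trans (ler_normB _ _))// ler_ltD ?fs//.
  rewrite (le_trans (ler_normB _ _))// !normrM lerD//.
    rewrite (@le_trans _ _ (a * `|f' s x - f' t x|))//.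
      exact: ler_wpM2r.
    by rewrite mulrC -ler_pdivlMr// ltW// fd.
  rewrite (@le_trans _ _ (`|s - t| * (c + 1)))//.
    by rewrite ler_wpM2l// (le_trans (cf' x))// lerDl.
  by rewrite -ler_pdivlMr// ltW.
Unshelve. all: by end_near. Qed.

(** * The error of the rectangle rule along the path *)

Lemma le_Rintegral_ae (R : realType) (d : measure_display)
    (T : measurableType d) (P : {measure set T -> \bar R}) (f g : T -> R) :
  P.-integrable setT (EFin \o f) -> P.-integrable setT (EFin \o g) ->
  {ae P, forall w, f w <= g w} ->
  \int[P]_w f w <= \int[P]_w g w.
Proof.
move=> fi gi fg.
have gfi : P.-integrable setT (EFin \o (fun w => g w - f w)).
  exact: (integrableB measurableT gi fi).
rewrite -subr_ge0 -RintegralB//.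
suff -> : \int[P]_w (g w - f w) = \int[P]_w `|g w - f w| by exact: Rintegral_ge0.
congr fine; apply: ae_eq_integral => //.
- exact: measurable_int gfi.
- exact: measurable_int (integrable_norm gfi).
- by apply: filterS fg => w fgw _; rewrite ger0_norm// subr_ge0.
Qed.

Lemma integrable_itv_weight (R : realType) (h : R -> R) (k : nat) (v t : R) :
  lebesgue_measure.-integrable `[0, t] (EFin \o h) ->
  lebesgue_measure.-integrable `[0, t]
    (EFin \o (fun s => (v - s) ^+ k * h s)).
Proof.
move=> hi; apply: (@integrableMr _ _ _ lebesgue_measure `[0, t]%classic
  (measurable_itv _) (fun s => (v - s) ^+ k) (EFin \o h)) => //.
  by apply: measurable_funX; apply: measurable_funB.
exists ((`|v| + `|t|) ^+ k); split; first exact: num_real.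
move=> M vM s /=; rewrite in_itv/= => /andP[s0 st].
rewrite normrX (le_trans _ (ltW vM))// lerXn2r// ?nnegrE ?addr_ge0//.
by rewrite (le_trans (ler_normB _ _))// lerD// !ger0_norm// (le_trans s0).
Qed.

(** On ]u, v] the weight is at most (v - u)^k. Integrals over the cell are kept as differences of
    integrals from 0, the form in which the martingales provide them, so that the bounds telescope.
    The case k = 1 serves for the drift, k = 2 for the bracket. *)
Lemma Rintegral_itvB_weight_le (R : realType) (h : R -> R) (k : nat) (u v : R) :
  0 <= u <= v ->
  lebesgue_measure.-integrable `[0, v] (EFin \o h) ->
  `|\int[lebesgue_measure]_(s in `[0, v]) ((v - s) ^+ k * h s) -
    \int[lebesgue_measure]_(s in `[0, u]) ((v - s) ^+ k * h s)| <=
  (v - u) ^+ k * (\int[lebesgue_measure]_(s in `[0, v]) `|h s| -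
    \int[lebesgue_measure]_(s in `[0, u]) `|h s|).
Proof.
move=> /andP[u0 uv] hi.
have iw := integrable_itv_weight k v hi.
have ni := integrable_norm hi.
rewrite !Rintegral_itvB ?bnd_simp//.
have sub : `]u, v]%classic `<=` `[0, v]%classic.
  by apply: subset_itvr; rewrite bnd_simp.
have iS f : lebesgue_measure.-integrable `[0, v] (EFin \o f) ->
    lebesgue_measure.-integrable `]u, v] (EFin \o f).
  by apply: integrableS.
rewrite (le_trans (le_normr_Rintegral _ (iS _ iw)))//.
rewrite -RintegralZl//; last exact: iS ni.
apply: le_Rintegral => //.
- exact: integrable_norm (iS _ iw).
- exact: (@integrableZl _ _ _ lebesgue_measure `]u, v]%classic
    (measurable_itv _) ((v - u) ^+ k) _ (iS _ ni)).
- move=> s /=; rewrite in_itv/= => /andP[us sv].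
  rewrite normrM ler_wpM2r// normrX lerXn2r ?nnegrE ?subr_ge0//.
  by rewrite ger0_norm ?subr_ge0// lerB// ltW.
Qed.

(** * Homogeneity of the generator and of its carre du champ *)

Section generator.
Context (R : realType) (E : completePseudoMetricType R).
Context (K : R -> R.-pker borel E ~> skorokhod E (+oo%E : \bar R)).
Context (D : set (E -> R)) (L : R -> (E -> R) -> E -> R).
Context (Dalg : bounded_subalgebra D) (Lgen : generators K D L).

Lemma subalgebra0 : D (fun=> 0).
Proof.
case: Dalg => _ D1 Dlin _.
by have := Dlin (-1) _ _ D1 D1; congr D; apply/funext => x; ring.
Qed.

Lemma generatorZ (s a : R) (f : E -> R) : 0 <= s -> D f ->
  L s (fun x => a * f x) = fun x => a * L s f x.
Proof.
move=> s0 Df; have [_ Llin _] := Lgen s0.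
have D0 := subalgebra0.
(* Linearity applied to 0 = 1 * 0 + 0 gives L 0 = L 0 + L 0. *)
have L0 : L s (fun=> 0) = fun=> 0.
  have := Llin 1 _ _ D0 D0.
  rewrite [X in L s X = _](_ : _ = fun=> 0); last by apply/funext => x; ring.
  move=> h; apply/funext => x; have := congr1 (fun g => g x) h => /= {}h.
  by apply: (addrI (L s (fun=> 0) x)); rewrite addr0 {3}h; ring.
transitivity (L s (fun x => a * f x + 0)).
  by congr (L s); apply/funext => x; rewrite addr0.
by rewrite Llin// L0; apply/funext => x; rewrite addr0.
Qed.

Lemma carre_du_champZ (s a : R) (f : E -> R) (x : E) : 0 <= s -> D f ->
  carre_du_champ (L s) (fun y => a * f y) x = a ^+ 2 * carre_du_champ (L s) f x.
Proof.
move=> s0 Df; rewrite /carre_du_champ.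
have Dd : D (fun y => (f y - f x) ^+ 2).
  have D0 := subalgebra0; case: Dalg => _ D1 Dlin DM.
  have Dfx : D (fun y => f y - f x).
    have := Dlin (- f x) _ _ D1 Df.
    by congr D; apply/funext => y; ring.
  by have := DM _ _ Dfx Dfx; congr D; apply/funext => y; ring.
have <- := congr1 (fun g => g x) (generatorZ (a ^+ 2) s0 Dd).
by congr (L s _ x); apply/funext => y; ring.
Qed.

End generator.

Lemma augmented_filtrationT (R : realType) (E : completePseudoMetricType R)
    (P : probability (skorokhod E +oo%E) R) (t : R) :
  augmented_filtration P t setT.
Proof.
split=> // s _; exists setT; split; last by rewrite setYK measure0.
have [h0 hD _] := 
  smallest_sigma_algebra setT (@coordinate_events R E +oo%E `[0, s]).
have := hD _ h0; by rewrite setD0.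
Qed.

Lemma measurable_eval (R : realType) (E : completePseudoMetricType R)
    (T : \bar R) (s : R) :
  measurable_fun setT ((fun w => w s) : skorokhod E T -> borel E).
Proof.
move=> _ B mB; rewrite setTI; apply: sub_sigma_algebra.
by exists s, B.
Qed.

Lemma bounded_measurable_eval (R : realType) (E : completePseudoMetricType R)
    (T : \bar R) (s : R) (f : borel E -> R) :
  bounded_measurable f ->
  bounded_measurable (fun w : skorokhod E T => f (w s)).
Proof.
move=> [mf /bounded_funEx[c cf]]; split; last by apply/bounded_funEx; exists c.
exact: (measurableT_comp mf (@measurable_eval R E T s)).
Qed.

(** Young's inequality |z| <= (y z^2 + 1/y) / 2, which plays the role of Cauchy-Schwarz. With y = m
    and E z^2 = O(m^-2), both terms are O(1/m). *)
Lemma norm_sub_le_sqr (R : realType) (y s sm z c : R) : 0 < y ->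
  `|s - sm - z| <= c ->
  `|s - sm| <= 2^-1 * y * z ^+ 2 + 2^-1 * y^-1 + c.
Proof.
move=> y0 h; have -> : s - sm = z + (s - sm - z) by ring.
rewrite (le_trans (ler_normD _ _))// lerD//.
rewrite -(ler_pM2l y0) -[z ^+ 2]real_normK ?num_real//.
rewrite mulrDr [X in _ + X]mulrCA mulfV ?gt_eqF// mulr1.
by have := sqr_ge0 (y * `|z| - 1); rewrite sqrrB1 exprMn; lra.
Qed.

Lemma euler_constant_le (R : realType) (y z a a0 c : R) : 0 < y -> 0 <= a0 ->
  z <= y^-1 ^+ 2 * (a - a0) ->
  2^-1 * y * z + (2^-1 * y^-1 + y^-1 * c) <= y^-1 * (2^-1 + 2^-1 * a + c).
Proof.
move=> y0 a00 zle.
have : y * z <= y^-1 * a.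
  rewrite -ler_pdivlMl// (le_trans zle)// expr2 -mulrA !ler_pM2l ?invr_gt0//.
  by rewrite gerBl.
by rewrite !mulrDr -!mulrA; lra.
Qed.

(** * Mean error of the Riemann sums *)

Section euler_error.
Context (R : realType) (E : completePseudoMetricType R).
Context (K : R -> R.-pker borel E ~> skorokhod E (+oo%E : \bar R)).
Context (P : probability (skorokhod E (+oo%E : \bar R)) R).
Context (D : set (E -> R)) (L : R -> (E -> R) -> E -> R) (V V' : R -> E -> R).
Context (Dalg : bounded_subalgebra D) (Lgen : generators K D L).
Context (VC : C1 D `[0, +oo[ V V') (calc : stochastic_calculus P D L).
Local Notation path := (skorokhod E (+oo%E : \bar R)).
Local Notation leb := (@lebesgue_measure R).

Let DV s : 0 <= s -> D (V s).
Proof. by move=> s0; have [|] := VC (t := s) _; rewrite //= in_itv/= s0. Qed.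

Let b (s : R) (w : path) : R := V' s (w s) + L s (V s) (w s).
Let G (s : R) (w : path) : R := carre_du_champ (L s) (V s) (w s).
(** The martingale of the stochastic calculus for s -> (v - s) [V s], whose time derivative
    contributes the term - [V s] to the drift. *)
Let N (v t : R) (w : path) : R :=
  (v - t) * V t (w t) - (v - 0) * V 0 (w 0)
  - \int[leb]_(s in `[0, t]) ((v - s) * b s w - V s (w s)).

Let calcN v :
  [/\ integrable_along P (fun s x => (v - s) * V' s x - V s x
        + L s (fun y => (v - s) * V s y) x),
      martingale P (N v)
    & martingale P (fun t w =>
        N v t w ^+ 2 - \int[leb]_(s in `[0, t]) ((v - s) ^+ 2 * G s w))].
Proof.
have [ib _ mM mM2] := calc (C1_affineM v Dalg VC).
have ME : (fun t (w : path) => (v - t) * V t (w t) - (v - 0) * V 0 (w 0) -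
    \int[leb]_(s in `[0, t]) ((v - s) * V' s (w s) - V s (w s)
      + L s (fun y => (v - s) * V s y) (w s))) = N v.
  apply/funext => t; apply/funext => w; congr (_ - _).
  apply: eq_Rintegral => s /set_mem/=; rewrite in_itv/= => /andP[s0 _].
  by rewrite (generatorZ Dalg Lgen _ s0 (DV s0)) /b; ring.
rewrite ME in mM; split; [exact: ib|exact: mM|].
move: mM2; congr martingale; apply/funext => t; apply/funext => w.
have NE := congr1 (fun f => f t w) ME; rewrite /= in NE; rewrite -NE; congr (_ - _).
apply: eq_Rintegral => s /set_mem/=; rewrite in_itv/= => /andP[s0 _].
by rewrite (carre_du_champZ Dalg Lgen _ _ s0 (DV s0)).
Qed.

Let mI (t : R) :
  measurable (`[0, t]%classic `*` setT : set (measurableTypeR R * path)).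
Proof. exact: measurableX. Qed.

Let ib t : 0 <= t ->
  (leb \x P)%E.-integrable (`[0, t]%classic `*` [set: path])
    (fun z => (b z.1 z.2)%:E).
Proof. by have [+ _ _ _] := calc VC; apply. Qed.

Let iG t : 0 <= t ->
  (leb \x P)%E.-integrable (`[0, t]%classic `*` [set: path])
    (fun z => (G z.1 z.2)%:E).
Proof. by have [_ + _ _] := calc VC; apply. Qed.

Let iwM (h : R -> path -> R) (v t : R) (k : nat) :
  (leb \x P)%E.-integrable (`[0, t]%classic `*` [set: path])
    (fun z => (h z.1 z.2)%:E) ->
  (leb \x P)%E.-integrable (`[0, t]%classic `*` [set: path])
    (fun z => ((v - z.1) ^+ k * h z.1 z.2)%:E).
Proof.
move=> ih.
apply: (@integrableMr _ _ _ (leb \x P)%E _ (mI t)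
  (fun z : R * path => (v - z.1) ^+ k) _ _ _ ih).
  apply: measurable_funX; apply: measurable_funB => //.
  exact: measurable_funTS measurable_fst.
exists ((`|v| + `|t|) ^+ k); split; first exact: num_real.
move=> M vM [s w] [/= + _]; rewrite in_itv/= => /andP[s0 st].
rewrite normrX (le_trans _ (ltW vM))// lerXn2r// ?nnegrE ?addr_ge0//.
by rewrite (le_trans (ler_normB _ _))// lerD// !ger0_norm// (le_trans s0).
Qed.

(** The stochastic calculus gives integrability of drifts only. The drift of (0 - s) [V s] is (0 -
    s) [b] - [V s], so V along the path is a difference of two integrable functions. *)
Let iV t : 0 <= t ->
  (leb \x P)%E.-integrable (`[0, t]%classic `*` [set: path])
    (fun z => (V z.1 (z.2 z.1))%:E).
Proof.
move=> t0; have [ib0 _ _] := calcN 0.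
have := integrableB (mI t) (iwM 0 1 (ib t0)) (ib0 _ t0).
apply: eq_integrable => // -[s w] /set_mem[/= + _].
rewrite in_itv/= => /andP[s0 _]; rewrite -EFinB; congr (_%:E).
by rewrite (generatorZ Dalg Lgen _ s0 (DV s0)) /b expr1; ring.
Qed.

Let iR (h : R -> path -> R) (t : R) :
  (leb \x P)%E.-integrable (`[0, t]%classic `*` [set: path])
    (fun z => (h z.1 z.2)%:E) ->
  P.-integrable setT (EFin \o (fun w => \int[leb]_(s in `[0, t]) h s w)) /\
  {ae P, forall w, leb.-integrable `[0, t] (EFin \o h^~ w)}.
Proof. exact: integrable_prod_section. Qed.

Let inorm (h : R -> path -> R) (t : R) :
  (leb \x P)%E.-integrable (`[0, t]%classic `*` [set: path])
    (fun z => (h z.1 z.2)%:E) ->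
  (leb \x P)%E.-integrable (`[0, t]%classic `*` [set: path])
    (fun z => (`|h z.1 z.2|)%:E).
Proof. by move=> /integrable_abse. Qed.

Let sqrN v t : 0 <= t ->
  measurable_fun setT (N v t) /\
  P.-integrable setT (EFin \o (fun w => N v t w ^+ 2)).
Proof.
move=> t0; have [_ [_ iN _] [_ iN2 _]] := calcN v; split.
  by apply/measurable_EFinP; apply: measurable_int (iN _ t0).
have := integrableD measurableT (iN2 _ t0)
  (@iR (fun s w => (v - s) ^+ 2 * G s w) _ (iwM v 2 (iG t0))).1.
apply: eq_integrable => // w _; rewrite /= -EFinD; congr (_%:E); ring.
Qed.

(** The absolute value lets [A] dominate the bracket with its weight, cell by cell. *)
Let A t := \int[P]_w \int[leb]_(s in `[0, t]) `|G s w|.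
Let d (u v : R) (w : path) : R := N v v w - N v u w.

(** By orthogonality the second moment of the increment is E(N_v^2 - N_u^2), which the bracket turns
    into the mean integral of (v - s)^2 [G] over the cell. *)
Let d_sqr (u v : R) : 0 <= u <= v ->
  [/\ measurable_fun setT (d u v),
      P.-integrable setT (EFin \o (fun w => d u v w ^+ 2))
    & \int[P]_w (d u v w ^+ 2) <= (v - u) ^+ 2 * (A v - A u)].
Proof.
clearbody N.
move=> /andP[u0 uv]; have v0 := le_trans u0 uv.
have [mNv Nv2] := sqrN v v0; have [mNu Nu2] := sqrN v u0.
have dE : (fun w => d u v w ^+ 2) = fun w =>
    (-2) * (N v u w * (N v v w - N v u w)) + (N v v w ^+ 2 - N v u w ^+ 2).
  by apply/funext => w; rewrite /d; ring.
have iB : P.-integrable setT (EFin \o (fun w => N v v w ^+ 2 - N v u w ^+ 2)).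
  exact: (integrableB measurableT Nv2 Nu2).
have iC : P.-integrable setT
    (EFin \o (fun w => N v u w * (N v v w - N v u w))).
  under [X in _.-integrable _ X]eq_fun do rewrite /= mulrBr EFinB.
  by apply: (integrableB measurableT); exact: integrable_mul_sqr.
split; first exact: measurable_funB.
  rewrite dE.
  have := integrableD measurableT (integrableZl measurableT (-2) iC) iB.
  by apply: eq_integrable => // w _.
have [_ mN [_ _ mN2]] := calcN v.
rewrite dE Rintegral_lin// (martingale_orthogonal mN mN) ?u0 ?lexx//.
rewrite mulr0 add0r RintegralB//.
pose J t w := \int[leb]_(s in `[0, t]) ((v - s) ^+ 2 * G s w).
have iJ t : 0 <= t -> P.-integrable setT (EFin \o J t).
  by move=> t0; exact: (@iR (fun s w => (v - s) ^+ 2 * G s w) _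
    (iwM v 2 (iG t0))).1.
have iA t : 0 <= t -> P.-integrable setT
    (EFin \o (fun w => \int[leb]_(s in `[0, t]) `|G s w|)).
  by move=> t0; exact: (@iR (fun s w => `|G s w|) _ (inorm (iG t0))).1.
have := mN2 u v setT; rewrite u0 uv => /(_ isT (augmented_filtrationT _ _)).
rewrite (RintegralB measurableT Nv2 (iJ _ v0)).
rewrite (RintegralB measurableT Nu2 (iJ _ u0)).
have swap (x y z t : R) : x - y = z - t -> x - z = y - t by lra.
move=> /swap ->.
rewrite -(RintegralB measurableT (iJ _ v0) (iJ _ u0)).
rewrite -(RintegralB measurableT (iA _ v0) (iA _ u0)).
rewrite -RintegralZl//; last exact: (integrableB measurableT (iA _ v0) (iA _ u0)).
apply: le_Rintegral_ae.
- exact: (integrableB measurableT (iJ _ v0) (iJ _ u0)).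
- apply: integrable_EFinZl => //.
  exact: (integrableB measurableT (iA _ v0) (iA _ u0)).
- apply: filterS (iR (iG v0)).2 => w iGw.
  rewrite (le_trans (ler_norm _))//.
  by apply: Rintegral_itvB_weight_le => //; rewrite u0.
Qed.

Let d_orthogonal (u v u' v' : R) : 0 <= u <= v -> v <= u' <= v' ->
  \int[P]_w (d u v w * d u' v' w) = 0.
Proof.
clearbody N.
move=> /andP[u0 uv] /andP[vu' uv']; have v0 := le_trans u0 uv.
have u'0 := le_trans v0 vu'; have v'0 := le_trans u'0 uv'.
have [mNv Nv2] := sqrN v v0; have [mNu Nu2] := sqrN v u0.
have u'v' : 0 <= u' <= v' by rewrite u'0.
have [md' d2' _] := d_sqr u'v'.
have [_ mN _] := calcN v; have [_ mN' _] := calcN v'.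
have [_ Nv'2] := sqrN v' v'0; have [_ Nu'2] := sqrN v' u'0.
under eq_Rintegral do rewrite {1}/d mulrBl.
rewrite RintegralB//; [|exact: integrable_mul_sqr..].
by rewrite !(martingale_orthogonal mN mN') ?subrr ?v0 ?u0// (le_trans uv).
Qed.

(** At t = v the weight v - t vanishes, so the boundary terms leave only the left endpoint value of
    the rectangle rule. *)
Let cell_increment (u v : R) (w : path) : 0 <= u <= v ->
  leb.-integrable `[0, v] (EFin \o (fun s => b s w)) ->
  leb.-integrable `[0, v] (EFin \o (fun s => V s (w s))) ->
  d u v w = - ((v - u) * V u (w u))
    + (\int[leb]_(s in `[0, v]) V s (w s) - \int[leb]_(s in `[0, u]) V s (w s))
    - (\int[leb]_(s in `[0, v]) ((v - s) ^+ 1 * b s w)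
       - \int[leb]_(s in `[0, u]) ((v - s) ^+ 1 * b s w)).
Proof.
move=> /andP[u0 uv] ibw iVw.
have v0 := le_trans u0 uv.
have iw := integrable_itv_weight 1 v ibw.
have NE t : 0 <= t <= v ->
    \int[leb]_(s in `[0, t]) ((v - s) * b s w - V s (w s)) =
    \int[leb]_(s in `[0, t]) ((v - s) ^+ 1 * b s w)
    - \int[leb]_(s in `[0, t]) V s (w s).
  move=> /andP[t0 tv].
  have iS f : leb.-integrable `[0, v] (EFin \o f) ->
      leb.-integrable `[0, t] (EFin \o f).
    by apply: integrableS => //; apply: subset_itvl; rewrite bnd_simp.
  rewrite -(RintegralB _ (iS _ iw) (iS _ iVw))//.
rewrite /d /N !NE ?lexx ?v0 ?u0//.
have ringE (x y z i i' j j' : R) :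
    (v - v) * x - z - (i - j) - ((v - u) * y - z - (i' - j')) =
    - ((v - u) * y) + (j - j') - (i - i') by ring.
exact: ringE.
Qed.

Let Z (m n : nat) (w : path) : R := \sum_(q < n) d (mesh m q) (mesh m q.+1) w.

Let meshS (m q : nat) : (0 < m)%N ->
  0 <= @mesh R m q <= @mesh R m q.+1 /\
  @mesh R m q.+1 - @mesh R m q = m%:R^-1.
Proof.
move=> m0; have m0' : 0 < m%:R :> R by rewrite ltr0n.
rewrite /mesh; split.
  by rewrite divr_ge0//= ler_pM2r ?invr_gt0// ler_nat.
by rewrite -mulrBl -natr1 addrAC subrr add0r mul1r.
Qed.

Let mesh_le (m p q : nat) : (p <= q)%N -> @mesh R m p <= @mesh R m q.
Proof. by move=> pq; rewrite /mesh ler_wpM2r ?invr_ge0// ler_nat. Qed.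

Let Z_S m n : Z m n.+1 = (fun w => Z m n w + d (mesh m n) (mesh m n.+1) w).
Proof.
clearbody d. by apply/funext => w; rewrite /Z big_ord_recr. Qed.

Let Z_sqr_integrable m n : (0 < m)%N ->
  measurable_fun setT (Z m n) /\
  P.-integrable setT (EFin \o (fun w => Z m n w ^+ 2)).
Proof.
clearbody d.
move=> m0; elim: n => [|n [mZ iZ]].
  have -> : Z m 0 = fun=> 0 by apply/funext => w; rewrite /Z big_ord0.
  split; first exact: measurable_cst.
  by apply: bounded_measurable_integrable; exact: bounded_measurable_cst.
have [md id _] := d_sqr (meshS n m0).1.
rewrite Z_S; split; first exact: measurable_funD.
exact: integrable_sqrD.
Qed.

Let Z_orthogonal m k n : (0 < m)%N -> (k <= n)%N ->
  \int[P]_w (Z m k w * d (mesh m n) (mesh m n.+1) w) = 0.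
Proof.
clearbody d.
move=> m0; have [mdn idn _] := d_sqr (meshS n m0).1.
elim: k => [_|k IH kn].
  under eq_Rintegral do rewrite /Z big_ord0 mul0r.
  by rewrite Rintegral_cst// mul0r.
have [mdk idk _] := d_sqr (meshS k m0).1.
have [mZ iZ] := Z_sqr_integrable k m0.
rewrite Z_S; under eq_Rintegral do rewrite mulrDl.
rewrite RintegralD//; [|exact: integrable_mul_sqr..].
rewrite (IH (ltnW kn)) add0r; apply: d_orthogonal; first exact: (meshS k m0).1.
by rewrite mesh_le//=; case/andP: (meshS n m0).1.
Qed.

(** Pythagoras for the orthogonal cell increments; the bounds of [d_sqr] telescope because all cells
    have length 1/m. *)
Let Z_sqr_le m n : (0 < m)%N ->
  \int[P]_w (Z m n w ^+ 2) <= (m%:R^-1) ^+ 2 * (A (mesh m n) - A (mesh m 0)).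
Proof.
clearbody A d.
move=> m0; elim: n => [|n IH].
  under eq_Rintegral do rewrite /Z big_ord0 expr0n/=.
  by rewrite Rintegral_cst// mul0r subrr mulr0.
have [mdn idn dn] := d_sqr (meshS n m0).1.
have [mZ iZ] := Z_sqr_integrable n m0.
have iZd := integrable_mul_sqr mZ mdn iZ idn.
have -> : (fun w => Z m n.+1 w ^+ 2) =
    fun w => 2 * (Z m n w * d (mesh m n) (mesh m n.+1) w)
      + (Z m n w ^+ 2 + d (mesh m n) (mesh m n.+1) w ^+ 2).
  apply/funext => w; rewrite Z_S.
  have ringE (x y : R) : (x + y) ^+ 2 = 2 * (x * y) + (x ^+ 2 + y ^+ 2) by ring.
  exact: ringE.
have iZd2 : P.-integrable setT (EFin \o
    (fun w => Z m n w ^+ 2 + d (mesh m n) (mesh m n.+1) w ^+ 2)).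
  exact: (integrableD measurableT iZ idn).
rewrite (Rintegral_lin 2 iZd iZd2) (Z_orthogonal m0 (leqnn n)) mulr0 add0r.
rewrite (RintegralD measurableT iZ idn).
rewrite (meshS n m0).2 in dn.
apply: le_trans (lerD IH dn) _; rewrite -mulrDr.
by rewrite addrC addrA subrK.
Qed.

Let S (t : R) (w : path) : R := \int[leb]_(s in `[0, t]) V s (w s).
Let Sm (m n : nat) (w : path) : R :=
  \sum_(q < n) V (mesh m q) (w (mesh m q)) / m%:R.
Let B (t : R) (w : path) : R := \int[leb]_(s in `[0, t]) `|b s w|.

(** By [cell_increment], what remains after subtracting [Z] is the weighted drift, with weight at
    most 1/m. *)
Let Z_euler m n w : (0 < m)%N ->
  leb.-integrable `[0, mesh m n] (EFin \o (fun s => b s w)) ->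
  leb.-integrable `[0, mesh m n] (EFin \o (fun s => V s (w s))) ->
  `|S (mesh m n) w - Sm m n w - Z m n w| <= m%:R^-1 * B (mesh m n) w.
Proof.
move=> m0 ibw iVw.
have iS k f : (k <= n)%N -> leb.-integrable `[0, mesh m n] (EFin \o f) ->
    leb.-integrable `[0, mesh m k] (EFin \o f).
  move=> kn; apply: integrableS => //; apply: subset_itvl.
  by rewrite bnd_simp mesh_le.
suff H k : (k <= n)%N ->
    `|S (mesh m k) w - Sm m k w - Z m k w| <= m%:R^-1 * B (mesh m k) w.
  exact: H.
elim: k => [_|k IH kn].
  rewrite /S /Sm /Z !big_ord0 /mesh mul0r set_itv1 Rintegral_set1.
  rewrite !subr0 normr0 mulr_ge0 ?invr_ge0//.
  by apply: Rintegral_ge0.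
have uv := (meshS k m0).1.
have := cell_increment uv (iS _ _ kn ibw) (iS _ _ kn iVw).
have := Rintegral_itvB_weight_le 1 uv (iS _ _ kn ibw).
rewrite (meshS k m0).2 expr1.
rewrite -/(S (mesh m k) w) -/(S (mesh m k.+1) w).
rewrite -/(B (mesh m k) w) -/(B (mesh m k.+1) w).
rewrite /Sm /Z !big_ord_recr/= -/(Sm m k w) -/(Z m k w).
move: (IH (ltnW kn)).
move: (S _ w) (S _ w) (B _ w) (B _ w) (Sm m k w) (Z m k w) (d _ _ w) => s s' c c' sm z dd.
set j := _ - Rintegral _ _ _; move: j => j.
set x := V _ _; move: x => x.
set i := m%:R^-1 => IH' jle ->.
have -> : s - (sm + x * i) - (z + (- (i * x) + (s - s') - j)) =
   s' - sm - z + j by ring.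
rewrite (le_trans (ler_normD _ _))// (le_trans (lerD IH' jle))//.
by rewrite -mulrDr addrC subrK.
Qed.

Let iS t : 0 <= t -> P.-integrable setT (EFin \o S t).
Proof. by move=> t0; exact: (@iR (fun s w => V s (w s)) _ (iV t0)).1. Qed.

Let bSm m n : bounded_measurable (Sm m n).
Proof.
case: (Dalg) => Db _ _ _.
elim: n => [|n IH].
  have -> : Sm m 0 = fun=> 0 by apply/funext => w; rewrite /Sm big_ord0.
  exact: bounded_measurable_cst.
have -> : Sm m n.+1 =
    fun w => m%:R^-1 * V (mesh m n) (w (mesh m n)) + Sm m n w.
  by apply/funext => w; rewrite /Sm big_ord_recr/= addrC mulrC.
apply: bounded_measurable_lin => //; apply: bounded_measurable_eval.
by apply: Db; apply: DV; rewrite /mesh divr_ge0.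
Qed.

Lemma integrable_potential (t : R) : 0 <= t ->
  (leb \x P)%E.-integrable (`[0, t]%classic `*` [set: path])
    (fun z => (V z.1 (z.2 z.1))%:E).
Proof. exact: iV. Qed.

Lemma bounded_measurable_riemann_sum (m n : nat) :
  bounded_measurable
    (fun w : path => \sum_(q < n) V (mesh m q) (w (mesh m q)) / m%:R).
Proof. exact: bSm. Qed.

Lemma riemann_sum_error : exists C : R -> R, forall m n : nat, (0 < m)%N ->
  \int[P]_w `|\sum_(q < n) V (mesh m q) (w (mesh m q)) / m%:R
     - \int[leb]_(s in `[0, mesh m n]) V s (w s)|
  <= m%:R^-1 * C (mesh m n).
Proof.
(* The first two terms come from Young's inequality applied to [Z], the last one from the drift. *)
exists (fun t => 2^-1 + 2^-1 * A t + \int[P]_w B t w) => m n m0.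
have t0 : 0 <= @mesh R m n by rewrite /mesh divr_ge0.
set t := @mesh R m n in t0 *.
have iB : P.-integrable setT (EFin \o B t).
  exact: (@iR (fun s w => `|b s w|) _ (inorm (ib t0))).1.
have iDiff : P.-integrable setT (EFin \o (fun w => Sm m n w - S t w)).
  have iSm := @bounded_measurable_integrable _ _ _ P _ (bSm m n).
  exact: (integrableB measurableT iSm (iS t0)).
have [mZ iZ] := Z_sqr_integrable n m0.
have Zle := Z_sqr_le n m0.
have A0 : 0 <= A (mesh m 0) by do 2 apply: Rintegral_ge0 => ? _.
have m0' : 0 < m%:R :> R by rewrite ltr0n.
have iA := finite_measure_integrable_cst P (2^-1 * m%:R^-1 : R) measurableT.
have iBZ : P.-integrable setT
    (EFin \o (fun w => 2^-1 * m%:R^-1 + m%:R^-1 * B t w)).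
  exact: (integrableD measurableT iA (integrable_EFinZl _ measurableT iB)).
have iAll : P.-integrable setT (EFin \o (fun w =>
    (2^-1 * m%:R) * Z m n w ^+ 2 + (2^-1 * m%:R^-1 + m%:R^-1 * B t w))).
  exact: (integrableD measurableT (integrable_EFinZl _ measurableT iZ) iBZ).
apply: (@le_trans _ _ (\int[P]_w ((2^-1 * m%:R) * Z m n w ^+ 2
    + (2^-1 * m%:R^-1 + m%:R^-1 * B t w)))).
  apply: le_Rintegral_ae => //; first exact: integrable_norm iDiff.
  have [_ ib'] := iR (ib t0).
  have [_ iV'] := @iR (fun s w => V s (w s)) _ (iV t0).
  apply: filterS2 ib' iV' => w ibw iVw.
  rewrite distrC addrA.
  exact: norm_sub_le_sqr m0' (Z_euler m0 ibw iVw).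
rewrite (Rintegral_lin _ iZ iBZ).
rewrite (RintegralD measurableT iA (integrable_EFinZl _ measurableT iB)).
have -> : \int[P]_w (cst (2^-1 * m%:R^-1) w) = 2^-1 * m%:R^-1 :> R.
  transitivity (2^-1 * m%:R^-1 * fine (P setT)); first exact: Rintegral_cst.
  by rewrite probability_setT mulr1.
rewrite (RintegralZl _ measurableT iB).
exact: (euler_constant_le _ m0' A0 Zle).
Qed.

End euler_error.

(** * First order decompositions *)

Lemma expR_lipschitz (R : realType) (k x y : R) : `|x| <= k -> `|y| <= k ->
  `|expR x - expR y| <= expR k * `|x - y|.
Proof.
wlog yx : x y / y <= x.
  move=> h xk yk; case: (leP y x) => [|/ltW] xy; first exact: h.
  by rewrite distrC [X in _ * X]distrC; exact: h.
move=> /ler_normlP[_ xk] _.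
rewrite !ger0_norm ?subr_ge0 ?ler_expR//.
have -> : expR x - expR y = expR x * (1 - expR (y - x)).
  by rewrite mulrBr mulr1 -expRD [x + _]addrC subrK.
apply: ler_pM; rewrite ?expR_ge0 ?ler_expR//.
  by rewrite subr_ge0 -expR0 ler_expR subr_le0.
by have := expR_ge1Dx (y - x); lra.
Qed.

(** Boundedness of V makes each section integrable, so the bound holds for every path and not just
    almost every one. *)
Lemma path_integral_bounded (R : realType) (E : completePseudoMetricType R)
    (P : probability (skorokhod E (+oo%E : \bar R)) R)
    (V : R -> E -> R) (t k : R) : 0 <= t ->
  measurable_fun (`[0, t]%classic `*` setT : set (measurableTypeR R * _))
    (fun z : R * skorokhod E (+oo%E : \bar R) => V z.1 (z.2 z.1)) ->
  (forall s x, 0 <= s <= t -> `|V s x| <= k) ->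
  let S (w : skorokhod E (+oo%E : \bar R)) :=
    \int[lebesgue_measure]_(s in `[0, t]) V s (w s) in
  measurable_fun setT S /\ forall w, `|S w| <= k * t.
Proof.
move=> t0 mV Vk S.
set path := skorokhod E (+oo%E : \bar R).
pose F (s : R) (w : path) := V s (w s).
pose A : set (measurableTypeR R) := `[0, t]%classic.
have mA : measurable A by exact: measurable_itv.
have At : @lebesgue_measure R A = t%:E.
  rewrite /A lebesgue_measure_itv/= lte_fin; case: ltP => //; first by rewrite sube0.
  by move=> t0'; congr (_%:E); apply/eqP; rewrite eq_le t0.
have Aoo (m : {measure set (measurableTypeR R) -> \bar R}) :
    m A = t%:E -> (m A < +oo)%E by move=> ->; exact: ltry.
have iF : (lebesgue_measure \x P)%E.-integrable (A `*` setT)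
    (fun z => (F z.1 z.2)%:E).
  apply: measurable_bounded_integrable => //; first exact: measurableX.
  - rewrite [X in (X < _)%E](_ : _ = t%:E) ?ltry//.
    transitivity (@lebesgue_measure R A * P setT)%E.
      exact: product_measure1E.
    by rewrite probability_setT mule1.
  - exists k; split; first exact: num_real.
    move=> M kM [s w] [/= + _]; rewrite /A/= in_itv/= => sA.
    by rewrite (le_trans (Vk _ _ sA))// ltW.
have [iS _] := integrable_prod_section mA iF.
split; first by apply/measurable_EFinP; exact: measurable_int iS.
move=> w.
have iw : lebesgue_measure.-integrable A (EFin \o F^~ w).
  apply: measurable_bounded_integrable => //; first exact: Aoo.
  - apply/(measurable_restrictT _ mA).
    have -> : (F^~ w) \_ A = ((fun z => F z.1 z.2) \_ (A `*` setT)) \o (pair^~ w).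
      apply/funext => s; rewrite /restrict.
      suff <- : ((s, w) \in A `*` [set: path]) = (s \in A) by [].
      by rewrite in_setX in_setT andbT.
    apply: (measurableT_comp _ (measurable_pair2 w)).
    exact: ((measurable_restrictT _ (measurableX mA measurableT)).1 mV).
  - exists k; split; first exact: num_real.
    move=> M kM s; rewrite /A/= in_itv/= => sA.
    by rewrite (le_trans (Vk _ _ sA))// ltW.
rewrite (le_trans (le_normr_Rintegral _ iw))//.
have -> : k * t = \int[lebesgue_measure]_(s in A) k.
  transitivity (k * fine (@lebesgue_measure R A)); first by rewrite At.
  by symmetry; exact: Rintegral_cst.
apply: le_Rintegral => //; first exact: integrable_norm iw.
  apply: measurable_bounded_integrable => //; first exact: Aoo.
  exact: bounded_cst.
by move=> s; rewrite /A/= in_itv/= => sA; exact: Vk.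
Qed.

(** With [alpha] and [beta] the integrals of a and b, the charges have densities m (a - b) and m (a
    / alpha - b / beta). *)
Lemma charge_first_order (R : realType) (d d' : measure_display)
    (T : measurableType d) (T' : measurableType d') (P : probability T R)
    (phi : T -> T') (a b : T -> R) (k c : R) (m : nat) :
  measurable_fun setT phi -> (0 < m)%N ->
  bounded_measurable a -> bounded_measurable b ->
  0 < k -> (forall w, k <= a w) -> (forall w, k <= b w) ->
  \int[P]_w `|a w - b w| <= m%:R^-1 * c ->
  exists r rbar : {charge set T' -> \bar R},
    [/\ forall f, bounded_measurable f ->
      \int[P]_w (f (phi w) * a w) =
        \int[P]_w (f (phi w) * b w) + m%:R^-1 * charge_integral r f /\
      \int[P]_w (f (phi w) * a w) / \int[P]_w a w =
        \int[P]_w (f (phi w) * b w) / \int[P]_w b w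
        + m%:R^-1 * charge_integral rbar f,
      (tv_norm r <= c%:E)%E & (tv_norm rbar <= (2 * k^-1 * c)%:E)%E].
Proof.
move=> mphi m0 ba bb k0 ka kb abc.
have m0' : 0 < m%:R :> R by rewrite ltr0n.
have bmI f : bounded_measurable f -> P.-integrable setT (EFin \o f).
  exact: bounded_measurable_integrable.
set alpha := \int[P]_w a w; set beta := \int[P]_w b w.
have cstE (x : R) : \int[P]_w (cst x w) = x.
  transitivity (x * fine (P setT)); first exact: Rintegral_cst.
  by rewrite probability_setT mulr1.
have int_ge f : bounded_measurable f -> (forall w, k <= f w) ->
    k <= \int[P]_w f w.
  move=> bf kf; rewrite -[k]cstE; apply: le_Rintegral => //; last exact: bmI.
  exact: finite_measure_integrable_cst.
have ak : k <= alpha by exact: int_ge.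
have bk : k <= beta by exact: int_ge.
have alpha0 : 0 < alpha by exact: lt_le_trans ak.
have beta0 : 0 < beta by exact: lt_le_trans bk.
have blin (x y : R) : bounded_measurable (fun w => x * a w + y * b w).
  apply: bounded_measurable_lin => //.
  by apply: bounded_measurableM => //; exact: bounded_measurable_cst.
have intlin (x y : R) (f : T' -> R) : bounded_measurable f ->
    \int[P]_w (f (phi w) * (x * a w + y * b w)) =
    x * \int[P]_w (f (phi w) * a w) + y * \int[P]_w (f (phi w) * b w).
  move=> [mf /bounded_funEx[M fM]].
  have bf : bounded_measurable (fun w => f (phi w)).
    split; first exact: measurableT_comp.
    by apply/bounded_funEx; exists M.
  have ia := bmI _ (bounded_measurableM bf ba).
  have ib := bmI _ (bounded_measurableM bf bb).
  rewrite -(RintegralZl y measurableT ib).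
  rewrite -(Rintegral_lin _ ia (integrable_EFinZl _ measurableT ib)).
  by congr Rintegral; apply/funext => w; ring.
have iab : P.-integrable setT (EFin \o (fun w => `|a w - b w|)).
  exact: integrable_norm (integrableB measurableT (bmI _ ba) (bmI _ bb)).
have [r [rE rtv]] := charge_density mphi (bmI _ (blin m%:R (- m%:R))).
have [rb [rbE rbtv]] :=
  charge_density mphi (bmI _ (blin (m%:R / alpha) (- (m%:R / beta)))).
exists r, rb; split.
- move=> f bf; rewrite rE// rbE// !intlin//.
  move: (\int[P]_w (f (phi w) * a w)) (\int[P]_w (f (phi w) * b w)) => u v.
  by split; field; rewrite ?gt_eqF.
- apply: le_trans rtv _; rewrite lee_fin.
  have -> : (fun w => `|m%:R * a w + - m%:R * b w|) =
      fun w => m%:R * `|a w - b w|.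
    by apply/funext => w; rewrite mulNr -mulrBr normrM (gtr0_norm m0').
  by rewrite (RintegralZl _ measurableT iab) -ler_pdivlMl.
apply: le_trans rbtv _; rewrite lee_fin.
have ab : `|beta - alpha| <= \int[P]_w `|a w - b w|.
  rewrite distrC -(RintegralB measurableT (bmI _ ba) (bmI _ bb)).
  by apply: le_normr_Rintegral => //; exact: (integrableB measurableT (bmI _ ba) (bmI _ bb)).
(* The density m (a / alpha - b / beta) splits as x (a - b) + x (beta - alpha) b / beta. Each part
   has L1 norm at most x E|a - b|, whence the factor 2; the bound k <= alpha then gives 2 c / k. *)
pose x := m%:R / alpha; pose y := x * `|beta - alpha| / beta.
have x0 : 0 < x by rewrite divr_gt0.
have iyb := integrable_EFinZl y measurableT (bmI _ bb).
apply: (@le_trans _ _ (\int[P]_w (x * `|a w - b w| + y * b w))).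
  apply: le_Rintegral => //.
  - exact: integrable_norm (bmI _ (blin _ _)).
  - exact: (integrableD measurableT (integrable_EFinZl x measurableT iab) iyb).
  - move=> w _.
    have -> : m%:R / alpha * a w + - (m%:R / beta) * b w =
        x * (a w - b w) + x * (beta - alpha) / beta * b w.
      by rewrite /x; field; rewrite !gt_eqF.
    have e1 : `|x * (a w - b w)| = x * `|a w - b w|.
      by rewrite normrM (gtr0_norm x0).
    have e2 : `|x * (beta - alpha) / beta * b w| = y * b w.
      rewrite normrM (gtr0_norm (lt_le_trans k0 (kb w))) normrM normfV.
      by rewrite (gtr0_norm beta0) normrM (gtr0_norm x0).
    by rewrite (le_trans (ler_normD _ _))// e1 e2.
rewrite (Rintegral_lin _ iab iyb) (RintegralZl _ measurableT (bmI _ bb)) -/beta.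
rewrite /y divfK ?gt_eqF// -mulrDr.
have h : \int[P]_w `|a w - b w| + `|beta - alpha| <= 2 * (m%:R^-1 * c).
  by move: ab abc; lra.
apply: le_trans (ler_wpM2l (ltW x0) h) _.
have c0 : 0 <= m%:R^-1 * c by rewrite (le_trans _ abc)//; exact: Rintegral_ge0.
have c0' : 0 <= c by rewrite pmulr_rge0 ?invr_gt0 in c0.
have -> : x * (2 * (m%:R^-1 * c)) = 2 * alpha^-1 * c.
  by rewrite /x; field; rewrite !gt_eqF.
by rewrite ler_wpM2r// ler_pM2l// lef_pV2.
Qed.

Lemma measurable_stop_path (R : realType) (E : completePseudoMetricType R)
    (t : R) : measurable_fun setT (@stop_path R E t).
Proof.
apply: (@measurability _ _ _ _ setT (@stop_path R E t)
  (@coordinate_events R E t%:E setT)) => //.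
move=> _ [_ [s [B [_ mB ->]]] <-]; rewrite setTI.
by apply: sub_sigma_algebra; exists (clamp t%:E s), B.
Qed.

Lemma expR_sum (R : realType) (n : nat) (x : 'I_n -> R) :
  expR (\sum_(p < n) x p) = \prod_(p < n) expR (x p).
Proof. by rewrite (big_morph _ (@expRD R) (@expR0 R)). Qed.

Lemma first_order_charges (R : realType) (E : completePseudoMetricType R)
    (P : probability (skorokhod E +oo%E) R)
    (K : R -> R.-pker borel E ~> skorokhod E (+oo%E : \bar R))
    (D : set (E -> R)) (L : R -> (E -> R) -> E -> R) (V : R -> E -> R) :
  continuous_case P K D L V ->
  exists C : R -> R, forall (m : nat) (t : R),
  exists r : {charge set (skorokhod E t%:E) -> \bar R} *
             {charge set (skorokhod E t%:E) -> \bar R},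
    forall n : nat, (0 < m)%N -> t = mesh m n ->
    let a (w : skorokhod E +oo%E) :=
      \prod_(p < n) expR (V (mesh m p) (w (mesh m p)) / m%:R) in
    let b (w : skorokhod E +oo%E) :=
      expR (\int[lebesgue_measure]_(s in `[0, t]) V s (w s)) in
    [/\ forall f : skorokhod E t%:E -> R, bounded_measurable f ->
      \int[P]_w (f (stop_path t w) * a w) =
        \int[P]_w (f (stop_path t w) * b w)
        + m%:R^-1 * charge_integral r.1 f /\
      \int[P]_w (f (stop_path t w) * a w) / \int[P]_w a w =
        \int[P]_w (f (stop_path t w) * b w) / \int[P]_w b w
        + m%:R^-1 * charge_integral r.2 f,
      (tv_norm r.1 <= (C t)%:E)%E & (tv_norm r.2 <= (C t)%:E)%E].
Proof.
case=> Dalg _ _ Lgen [V' VC] _ _ calc.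
have Db : forall g, D g -> bounded_measurable (g : borel E -> R) by case: Dalg.
have /choice[k kP] := fun T => C1_bounded T Db VC.
have [C0 C0P] := riemann_sum_error Dalg Lgen VC calc.
pose C1 t := expR (k t * t) * C0 t.
exists (fun t => Num.max (C1 t) (2 * (expR (- (k t * t)))^-1 * C1 t)) => m t.
(* The charges are indexed by the time t, which fixes their path space; off the mesh any charge will
   do. *)
have [[m0 [n tE]]|no] := pselect ((0 < m)%N /\ exists n, t = mesh m n); last first.
  have i0 : P.-integrable setT (EFin \o (fun=> 0 : R)).
    by apply: bounded_measurable_integrable; exact: bounded_measurable_cst.
  have [r _] := charge_density (@measurable_stop_path R E t) i0.
  by exists (r, r) => n m0 tE; exfalso; apply: no; split => //; exists n.
have m0' : 0 < m%:R :> R by rewrite ltr0n.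
have t0 : 0 <= t by rewrite tE /mesh divr_ge0.
pose S (w : skorokhod E +oo%E) :=
  \int[lebesgue_measure]_(s in `[0, t]) V s (w s).
pose Sm (w : skorokhod E +oo%E) :=
  \sum_(q < n) V (mesh m q) (w (mesh m q)) / m%:R.
have mV : measurable_fun (`[0, t]%classic `*` setT : set (measurableTypeR R * _))
    (fun z : R * skorokhod E (+oo%E : \bar R) => V z.1 (z.2 z.1)).
  apply/measurable_EFinP.
  exact: measurable_int (integrable_potential Dalg Lgen VC calc t0).
have [mS Sk] := path_integral_bounded P t0 mV (kP t).
have [mSm _] := bounded_measurable_riemann_sum Dalg VC m n.
have k0 : 0 <= k t.
  by apply: le_trans (kP t 0 point _); rewrite ?lexx.
have Smk w : `|Sm w| <= k t * t.
  rewrite (le_trans (ler_norm_sum _ _ _))//.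
  apply: (@le_trans _ _ (\sum_(q < n) k t / m%:R)).
    apply: ler_sum => q _; rewrite normrM normfV (gtr0_norm m0').
    rewrite ler_wpM2r ?invr_ge0 ?ler0n// kP// tE /mesh divr_ge0//=.
    by rewrite ler_pM2r ?invr_gt0// ler_nat ltnW.
  rewrite sumr_const card_ord -[leLHS]mulr_natr.
  by rewrite [X in _ <= _ * X]tE /mesh mulrA mulrAC.
have bexp (f : skorokhod E +oo%E -> R) : measurable_fun setT f ->
    (forall w, `|f w| <= k t * t) ->
    bounded_measurable (fun w => expR (f w)) /\
    forall w, expR (- (k t * t)) <= expR (f w).
  move=> mf fk; split; last by move=> w; rewrite ler_expR; have := fk w; rewrite ler_norml => /andP[].
  split; first exact: measurableT_comp.
  apply/bounded_funEx; exists (expR (k t * t)) => w.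
  by rewrite ger0_norm ?expR_ge0// ler_expR (le_trans (ler_norm _)).
have [ba a0] := bexp _ mSm Smk; have [bb b0] := bexp _ mS Sk.
have iD : P.-integrable setT (EFin \o (fun w => `|Sm w - S w|)).
  apply: integrable_norm; apply: bounded_measurable_integrable.
  split; first exact: measurable_funB.
  apply/bounded_funEx; exists (k t * t + k t * t) => w.
  apply: le_trans (ler_normB _ _) _.
  by apply: lerD; [exact: Smk|exact: Sk].
have abC : \int[P]_w `|expR (Sm w) - expR (S w)| <= m%:R^-1 * C1 t.
  apply: (@le_trans _ _ (\int[P]_w (expR (k t * t) * `|Sm w - S w|))).
    apply: le_Rintegral => //.
    - apply: integrable_norm.
      exact: (integrableB measurableT (bounded_measurable_integrable _ ba)
        (bounded_measurable_integrable _ bb)).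
    - exact: integrable_EFinZl.
    - by move=> w _; apply: expR_lipschitz; [exact: Smk|exact: Sk].
  rewrite (RintegralZl _ measurableT iD) /C1 mulrCA ler_pM2l ?expR_gt0//.
  by rewrite /S tE; exact: C0P.
have [r [rb [H rtv rbtv]]] := charge_first_order (@measurable_stop_path R E t)
  m0 ba bb (expR_gt0 _) a0 b0 abC.
exists (r, rb) => n' _ tE' a b.
have -> : a = fun w => expR (Sm w).
  apply/funext => w; rewrite /a /Sm expR_sum.
  (* As m > 0, the index n is determined by m and t. *)
  suff -> : n' = n by [].
  move: tE; rewrite tE' /mesh => /(congr1 (fun x => x * m%:R)).
  by rewrite !divfK ?gt_eqF// => /eqP; rewrite eqr_nat => /eqP.
split; [exact: H| |].
- by rewrite (le_trans rtv)// lee_fin le_max lexx.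
- by rewrite (le_trans rbtv)// lee_fin le_max lexx orbT.
Qed.

(** * Measurability of the evaluation map and case (D) *)

Lemma measurable_fun_select (d d' : measure_display) (T : measurableType d)
    (T' : measurableType d') (h : T -> nat) (g : nat -> T -> T') :
  (forall j, measurable (h @^-1` [set j])) ->
  (forall j, measurable_fun setT (g j)) ->
  measurable_fun setT (fun z => g (h z) z).
Proof.
move=> mh mg _ B mB; rewrite setTI.
have -> : (fun z => g (h z) z) @^-1` B =
    \bigcup_j ((h @^-1` [set j]) `&` (g j @^-1` B)).
  apply/seteqP; split => z /=; first by move=> Bz; exists (h z).
  by move=> [j _ [/= <-]].
apply: bigcupT_measurable => j; apply: measurableI => //.
by rewrite -[_ @^-1` _]setTI; exact: mg.
Qed.

Lemma measurable_truncn_preimage (R : realType) (d : measure_display)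
    (T : measurableType d) (h : T -> R) (j : nat) :
  measurable_fun setT h ->
  measurable ((fun z => Num.truncn (Num.max 0 (h z))) @^-1` [set j]).
Proof.
move=> mh.
have mm : measurable_fun setT (fun z => Num.max 0 (h z)).
  by apply: measurable_maxr.
have -> : (fun z => Num.truncn (Num.max 0 (h z))) @^-1` [set j] =
    [set: T] `&` (fun z => Num.max 0 (h z)) @^-1` `[j%:R, j.+1%:R[%classic.
  rewrite setTI; apply/seteqP; split => z /=; rewrite in_itv/=.
    by move=> <-; apply: truncn_itv; rewrite le_max lexx.
  exact: truncn_def.
by apply: mm => //; exact: measurable_itv.
Qed.

(** The limit lies in an open U exactly when, for some j, the sequence eventually stays in the open
    set [W j] of points lying well inside U. *)
Lemma measurable_cvg_borel (R : realType) (E : completePseudoMetricType R)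
    (d : measure_display) (T : measurableType d) (g : nat -> T -> borel E)
    (l : T -> borel E) :
  (forall k, measurable_fun setT (g k)) ->
  (forall z, (g k z : E) @[k --> \oo] --> (l z : E)) ->
  measurable_fun setT l.
Proof.
move=> mg gl; apply: (@measurability _ _ _ _ setT l (@open E)) => //.
move=> _ [U oU <-]; rewrite setTI.
pose del (j : nat) : R := j.+1%:R^-1.
have del0 j : 0 < del j by rewrite /del invr_gt0 ltr0n.
pose W j : set E := interior [set x : E | ball x (del j) `<=` U].
have -> : l @^-1` U =
    \bigcup_j \bigcup_N \bigcap_(k in [set k | (N <= k)%N]) (g k @^-1` W j).
  apply/seteqP; split => z /=.
    move=> Ulz.
    have : nbhs (l z : E) U by exact: open_nbhs_nbhs.
    rewrite -nbhs_ballE => -[e /= e0 eU].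
    pose j := Num.truncn (2 / e).
    (* One [del j] reaches a neighbour of the limit, the other keeps a ball around that neighbour
       inside U. *)
    have je : del j + del j <= e.
      rewrite -mulr2n -mulr_natr mulrC /del ler_pdivrMr ?ltr0n//.
      by rewrite mulrC -ler_pdivrMr// ltW// truncnS_gt.
    exists j => //.
    have Wl : nbhs (l z : E) (W j).
      apply: open_nbhs_nbhs; split; first exact: open_interior.
      rewrite /W /interior/= -nbhs_ballE; exists (del j) => //= y ly.
      move=> x yx; apply: eU; apply: (le_ball je); exact: ball_triangle ly yx.
    have [N _ NW] := gl z _ Wl.
    by exists N => // k /= Nk; exact: NW.
  move=> [j _ [N _ NW]].
  have [M _ Mb] := gl z _ (nbhsx_ballx _ _ (del0 j)).
  have /= := NW (maxn N M) (leq_maxl _ _).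
  move=> /interior_subset/=; apply; apply: ball_sym; apply: Mb => /=.
  exact: leq_maxr.
apply: bigcupT_measurable => j; apply: bigcupT_measurable => N.
apply: bigcap_measurableType => k _.
rewrite -[_ @^-1` _]setTI; apply: mg => //.
by apply: sub_sigma_algebra; exact: open_interior.
Qed.

(** A path is evaluated at grid times [u k s] that decrease to s strictly from the right, as the
    successor in [u] ensures; right continuity gives convergence. *)
Lemma measurable_eval_prod (R : realType) (E : completePseudoMetricType R) :
  measurable_fun setT
    ((fun z => z.2 z.1) : measurableTypeR R * skorokhod E (+oo%E : \bar R) ->
       borel E).
Proof.
pose u (k : nat) (s : R) : R :=
  (Num.truncn (Num.max 0 (s * k.+1%:R))).+1%:R / k.+1%:R.
pose g (k : nat) (z : measurableTypeR R * skorokhod E (+oo%E : \bar R)) :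
  borel E := z.2 (u k z.1).
apply: (@measurable_cvg_borel R E _ _ g).
  move=> k; apply: (@measurable_fun_select _ _ _ _
    (fun z : measurableTypeR R * skorokhod E (+oo%E : \bar R) =>
       Num.truncn (Num.max 0 (z.1 * k.+1%:R)))
    (fun j z => z.2 (j.+1%:R / k.+1%:R) : borel E)).
    move=> j; apply: measurable_truncn_preimage; apply: measurable_funM => //.
  move=> j; apply: (measurableT_comp (measurable_eval _)).
  exact: measurable_snd.
move=> [s w]; rewrite /g/=.
rewrite (skorokhod_clamp w s) /=.
set t := Num.max 0 s.
have t0 : 0 <= t by rewrite le_max lexx.
have uE k : t < u k s <= t + k.+1%:R^-1.
  have k0 : 0 < k.+1%:R :> R by rewrite ltr0n.
  have -> : u k s = (Num.truncn (t * k.+1%:R)).+1%:R / k.+1%:R.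
    by rewrite /u maxr_pMl ?mul0r// ltW.
  rewrite ltr_pdivlMr// truncnS_gt ler_pdivrMr// mulrDl mulVf ?gt_eqF//.
  by rewrite -natr1 lerD2r truncn_le mulr_ge0// ltW.
have ut : u k s @[k --> \oo] --> t^'+.
  move=> A [e /= e0 eA]; have [N _ NP] := near_infty_natSinv_lt (PosNum e0).
  exists N => // k /= Nk; have /andP[tu ue] := uE k.
  apply: eA => //=; rewrite distrC ger0_norm ?subr_ge0 ?(ltW tu)//.
  have ke : k.+1%:R^-1 < e := NP k Nk.
  by rewrite ltrBlDl (le_lt_trans ue)// ltrD2l.
exact: (cvg_comp _ _ ut (proj1 (skorokhod_cadlag w t))).
Qed.

Lemma measurable_step_path (R : realType) (E : completePseudoMetricType R)
    (d : measure_display) (T : measurableType d) (X : nat -> T -> borel E) :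
  (forall n, measurable_fun setT (X n)) ->
  measurable_fun setT (fun w => @step_path R E (fun n => X n w)).
Proof.
move=> mX; apply: (@measurability _ _ _ _ setT _
  (@coordinate_events R E +oo%E setT)) => //.
move=> _ [_ [s [B [_ mB ->]]] <-].
by have := mX (Num.truncn s) measurableT B mB.
Qed.

(** * Exponential weights along step paths *)

Lemma Rintegral_step (R : realType) (phi : nat -> R) (n : nat) :
  \int[lebesgue_measure]_(s in `[(0 : R), n%:R]) phi (Num.truncn s) =
  \sum_(k < n) phi k.
Proof.
have mphi : measurable_fun setT (fun s : R => phi (Num.truncn s)).
  have -> : (fun s : R => phi (Num.truncn s)) =
      (fun s => (fun k (_ : R) => phi k) (Num.truncn (Num.max 0 s)) s).
    apply/funext => s /=; congr phi; exact: truncn_clamp.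
  apply: (@measurable_fun_select _ _ _ _ _ (fun k (_ : R) => phi k)) => j.
    exact: measurable_truncn_preimage.
  exact: measurable_cst.
have leb_le k : (@lebesgue_measure R `[0%R, k%:R] <= (k%:R)%:E)%E.
  rewrite lebesgue_measure_itv/=; case: ifP => _; last by rewrite lee_fin.
  by rewrite sube0.
have iphi k : (@lebesgue_measure R).-integrable `[0, k%:R]
    (EFin \o (fun s : R => phi (Num.truncn s))).
  apply: measurable_bounded_integrable => //.
  - exact: (@le_lt_trans _ _ (k%:R%:E) _ _ (leb_le k) (ltry _)).
  - exact: measurable_funTS.
  - exists (\sum_(i < k.+1) `|phi i|); split; first exact: num_real.
    move=> M kM s /=; rewrite in_itv/= => /andP[s0 sk].
    have tk : (Num.truncn s < k.+1)%N.
      by rewrite ltnS truncn_le_nat (le_lt_trans sk)// ltr_nat.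
    rewrite (le_trans _ (ltW kM))// (bigD1 (Ordinal tk))//= lerDl.
    by apply: sumr_ge0.
elim: n => [|n IH]; first by rewrite set_itv1 Rintegral_set1 big_ord0.
rewrite big_ord_recr/= -IH; apply/eqP; rewrite addrC -subr_eq; apply/eqP.
rewrite Rintegral_itvB ?bnd_simp ?ler_nat//.
have iS : (@lebesgue_measure R).-integrable `]n%:R, n.+1%:R[
    (EFin \o (fun s : R => phi (Num.truncn s))).
  apply: integrableS (iphi n.+1) => //.
  by apply: subset_itv; rewrite bnd_simp.
rewrite -Rintegral_itv_bndo_bndc//.
transitivity (\int[lebesgue_measure]_(s in `](n%:R : R), n.+1%:R[) phi n).
  apply: eq_Rintegral => s /set_mem/=; rewrite in_itv/= => /andP[ns sn].
  by rewrite (@truncn_def _ s n) // sn ltW.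
transitivity (phi n * fine (@lebesgue_measure R `](n%:R : R), n.+1%:R[)).
  exact: Rintegral_cst.
rewrite lebesgue_measure_itv/= lte_fin ltr_nat ltnSn/=.
by rewrite -natr1 addrC addKr mulr1.
Qed.

(** Each block of m consecutive mesh points contributes m equal factors, the m-th roots of [g k]. *)
Lemma prod_divn (R : realType) (g : nat -> R) (m n : nat) : (0 < m)%N ->
  (forall k, 0 < g k) ->
  \prod_(p < n * m) expR (ln (g (p %/ m)%N) / m%:R) = \prod_(k < n) g k.
Proof.
move=> m0 g0; have m0' : m%:R != 0 :> R by rewrite pnatr_eq0 -lt0n.
elim: n => [|n IH]; first by rewrite !big_ord0.
rewrite big_ord_recr/= -IH.
rewrite -!(big_mkord xpredT (fun p => expR (ln (g (p %/ m)%N) / m%:R))).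
rewrite mulSn addnC (big_cat_nat (n := (n * m)))//= ?leq_addr//; congr (_ * _).
rewrite -{1}[(n * m)%N]add0n big_addn addKn big_mkord.
under eq_bigr => p _ do rewrite addnC divnMDl// divn_small// addn0.
rewrite prodr_const card_ord -expRM_natl mulrCA mulfV// mulr1.
by rewrite lnK// posrE.
Qed.

Lemma truncn_mesh (R : realType) (m p : nat) : (0 < m)%N ->
  Num.truncn (@mesh R m p) = (p %/ m)%N.
Proof.
move=> m0; have m0' : 0 < m%:R :> R by rewrite ltr0n.
apply: truncn_def; rewrite /mesh ler_pdivlMr// ltr_pdivrMr//.
by rewrite -!natrM ler_nat ltr_nat leq_divM/= ltn_ceil.
Qed.

Lemma Rintegral_step_law (R : realType) (E : completePseudoMetricType R)
    (d : measure_display) (T : measurableType d) (Pr : probability T R)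
    (X : nat -> {RV Pr >-> borel E})
    (P : probability (skorokhod E +oo%E) R)
    (H : skorokhod E (+oo%E : \bar R) -> R) :
  step_law X P -> bounded_measurable H ->
  \int[P]_w H w = \int[Pr]_w H (step_path (fun n => X n w)).
Proof.
move=> XP bH.
have mS := @measurable_step_path R E d T (fun n => X n)
  (fun n => measurable_funPT (X n)).
congr fine; transitivity
  (\int[pushforward Pr (fun w => step_path (fun n => X n w))]_w (H w)%:E)%E.
  by apply: eq_measure_integral => A mA _; exact: XP.
rewrite integral_pushforward//.
- by case: bH => mH _; exact/measurable_EFinP.
- apply: (@bounded_measurable_integrable _ _ _ Pr
    (fun w => H (step_path (fun n => X n w)))).
  case: bH => mH /bounded_funEx[c Hc]; split; first exact: measurableT_comp.
  by apply/bounded_funEx; exists c.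
Qed.

Section discrete_case.
Context (R : realType) (E : completePseudoMetricType R).
Context (d : measure_display) (T : measurableType d) (Pr : probability T R).
Context (X : nat -> {RV Pr >-> borel E}) (G : nat -> E -> R).
Context (P : probability (skorokhod E (+oo%E : \bar R)) R).
Context (Gb : log_bounded G) (XP : step_law X P).

Let V (t : R) (x : E) : R := ln (G (Num.truncn t) x).

Let bV t : bounded_measurable (V t : borel E -> R).
Proof.
have [G0 mG bG] := Gb (Num.truncn t); split => //.
exact: (measurableT_comp (@measurable_ln R) mG).
Qed.

Lemma nu_mesh_gamma (m n : nat) (f : borel E -> R) :
  (0 < m)%N -> bounded_measurable f ->
  nu_mesh V P m (n * m) f = gamma X G n f.
Proof.
move=> m0 bf; have m0' : m%:R != 0 :> R by rewrite pnatr_eq0 -lt0n.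
have meshE : @mesh R m (n * m) = n%:R by rewrite /mesh natrM mulfK.
rewrite /nu_mesh /Lambda_mesh.
have -> : (fun w : skorokhod E +oo%E =>
    f (stop_path (mesh m (n * m)) w (mesh m (n * m))) *
    \prod_(p < n * m) expR (V (mesh m p) (w (mesh m p)) / m%:R)) =
    fun w => f (w n%:R) *
    \prod_(p < n * m) expR (V (mesh m p) (w (mesh m p)) / m%:R).
  apply/funext => w; congr (f _ * _).
  by rewrite /= meshE minxx max_r// ler0n.
rewrite (Rintegral_step_law XP); last first.
  apply: bounded_measurableM; first exact: bounded_measurable_eval.
  elim: (n * m)%N => [|k IH].
    under eq_fun do rewrite big_ord0; exact: bounded_measurable_cst.
  under eq_fun do rewrite big_ord_recr/=.
  apply: bounded_measurableM => //.
  apply: (@bounded_measurable_eval R E +oo%E (mesh m k)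
    (fun x => expR (V (mesh m k) x / m%:R))).
  have [mV /bounded_funEx[c Vc]] := bV (mesh m k).
  split.
    by apply: measurableT_comp => //; apply: measurable_funM.
  apply/bounded_funEx; exists (expR (c / m%:R)) => x.
  rewrite ger0_norm ?expR_ge0// ler_expR ler_wpM2r ?invr_ge0//.
  by rewrite (le_trans (ler_norm _)).
apply: eq_Rintegral => w _ /=.
rewrite natrK; congr (_ * _).
rewrite -(@prod_divn _ (fun k => G k (X k w)) m n)//; last first.
  by move=> k; have [+ _ _] := Gb k; apply.
by apply: eq_bigr => p _; rewrite /V truncn_mesh.
Qed.

Lemma nu_gamma (n : nat) (f : borel E -> R) : bounded_measurable f ->
  nu V P n%:R f = gamma X G n f.
Proof.
move=> bf; rewrite /nu /Lambda.
have -> : (fun w : skorokhod E +oo%E => f (stop_path n%:R w n%:R) *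
     expR (\int[lebesgue_measure]_(s in `[0, n%:R]) V s (w s))) =
   fun w => f (w n%:R) *
     expR (\int[lebesgue_measure]_(s in `[0, n%:R]) V s (w s)).
  by apply/funext => w; congr (f _ * _); rewrite /= minxx max_r// ler0n.
have /choice[c Vc] : forall k, exists c : R, forall x, `|ln (G k x)| <= c.
  by move=> k; have [_ _ /bounded_funEx] := Gb k.
(* The index n is included because the closed interval contains the time s = n. *)
pose M : R := \sum_(k < n.+1) `|c k|.
have VM s x : 0 <= s <= n%:R -> `|V s x| <= M.
  move=> /andP[s0 sn]; have tn : (Num.truncn s < n.+1)%N.
    by rewrite ltnS truncn_le_nat (le_lt_trans sn)// ltr_nat.
  rewrite /M (bigD1 (Ordinal tn))//= (le_trans (Vc _ x))//.
  by rewrite (le_trans (ler_norm _))// lerDl sumr_ge0.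
have mV : measurable_fun
    (`[0, n%:R]%classic `*` setT : set (measurableTypeR R * _))
    (fun z : R * skorokhod E (+oo%E : \bar R) => V z.1 (z.2 z.1)).
  apply: measurable_funTS.
  have -> : (fun z : R * skorokhod E (+oo%E : \bar R) => V z.1 (z.2 z.1)) =
      (fun z => (fun k (z : R * skorokhod E (+oo%E : \bar R)) =>
        ln (G k (z.2 z.1))) (Num.truncn (Num.max 0 z.1)) z).
    by apply/funext => z; rewrite /V [in LHS](truncn_clamp z.1).
  apply: (@measurable_fun_select _ _ (measurableTypeR R * skorokhod E +oo%E)%type _
    (fun z => Num.truncn (Num.max 0 z.1))
    (fun k z => ln (G k (z.2 z.1)))) => k.
    exact: measurable_truncn_preimage.
  have [_ mG _] := Gb k.
  apply: (measurableT_comp (@measurable_ln R)).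
  exact: (measurableT_comp mG (@measurable_eval_prod R E)).
have [mS Sk] := path_integral_bounded P (ler0n R n) mV VM.
rewrite (Rintegral_step_law XP); last first.
  apply: bounded_measurableM; first exact: bounded_measurable_eval.
  split; first exact: measurableT_comp.
  apply/bounded_funEx; exists (expR (M * n%:R)) => w.
  by rewrite ger0_norm ?expR_ge0// ler_expR (le_trans (ler_norm _)).
apply: eq_Rintegral => w _ /=.
rewrite natrK; congr (_ * _).
rewrite (Rintegral_step (fun k => ln (G k (X k w)))) expR_sum.
by apply: eq_bigr => k _; rewrite lnK// posrE; have [+ _ _] := Gb k; apply.
Qed.

End discrete_case.

Theorem theorem3p1 (R : realType) (E : completePseudoMetricType R)
    (hE : polish E) :
  (forall (d : measure_display) (T : measurableType d) (Pr : probability T R)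
      (X : nat -> {RV Pr >-> borel E}) (G : nat -> E -> R)
      (P : probability (skorokhod E +oo%E) R),
    markov_chain X -> log_bounded G -> step_law X P ->
    let V : R -> E -> R := fun t x => ln (G (Num.truncn t) x) in
    forall (m n : nat) (f : borel E -> R),
      (0 < m)%N -> bounded_measurable f ->
      [/\ nu_mesh V P m (n * m) f = nu V P n%:R f,
          nu V P n%:R f = gamma X G n f,
          mu_mesh V P m (n * m) f = mu V P n%:R f
        & mu V P n%:R f = eta X G n f]) /\
  (forall (P : probability (skorokhod E +oo%E) R)
      (K : R -> R.-pker borel E ~> skorokhod E (+oo%E : \bar R))
      (D : set (E -> R)) (L : R -> (E -> R) -> E -> R) (V : R -> E -> R),
    continuous_case P K D L V ->
    exists r rbar : forall (m : nat) (t : R),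
        {charge set (skorokhod E t%:E) -> \bar R},
      (forall (m n : nat) (f : skorokhod E (mesh m n)%:E -> R),
        (0 < m)%N -> bounded_measurable f ->
        Lambda_mesh V P f =
          Lambda V P f + m%:R^-1 * charge_integral (r m (mesh m n)) f /\
        Qlaw_mesh V P f =
          Qlaw V P f + m%:R^-1 * charge_integral (rbar m (mesh m n)) f) /\
      (forall t : R,
        (ereal_sup [set maxe (tv_norm (rbar m t)) (tv_norm (r m t)) |
           m in [set m : nat | (0 < m)%N /\ exists n : nat, t = mesh m n]]
         < +oo)%E)).
Proof.
split=> [d T Pr X G P _ Gb XP V m n f m0 bf|P K D L V H].
  have b1 : bounded_measurable ((fun=> 1) : borel E -> R).
    exact: bounded_measurable_cst.
  have mesh_f := nu_mesh_gamma (G := G) Gb XP n m0.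
  have time_f := nu_gamma (G := G) Gb XP n.
  have mesh_q : mu_mesh V P m (n * m) f =
    nu_mesh V P m (n * m) f / nu_mesh V P m (n * m) (fun=> 1) by [].
  have time_q : mu V P n%:R f = nu V P n%:R f / nu V P n%:R (fun=> 1) by [].
  by split; rewrite ?mesh_q ?time_q ?mesh_f ?time_f.
have [C HC] := first_order_charges H.
pose c m t := cid (HC m t).
exists (fun m t => (sval (c m t)).1), (fun m t => (sval (c m t)).2).
split=> [m n f m0 bf|t].
  have [+ _ _] := svalP (c m (mesh m n)) n m0 erefl.
  move=> /(_ f bf)[rE rbE]; split; first exact: rE.
  rewrite /Qlaw_mesh /Qlaw /Lambda_mesh /Lambda.
  (* The normalising constants are the masses of the constant function 1, hence the integrals of the
     densities. *)
  under [X in _ / X = _]eq_Rintegral do rewrite mul1r.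
  under [X in _ = _ / X + _]eq_Rintegral do rewrite mul1r.
  exact: rbE.
apply: (@le_lt_trans _ _ (C t)%:E); last exact: ltry.
apply: ge_ereal_sup => _ [m [m0 [n tE]] <-].
have [_ rtv rbtv] := svalP (c m t) n m0 tE.
rewrite ge_max; apply/andP; split; [exact: rbtv|exact: rtv].
Qed.
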